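(* Let $(G,K)=(\mathrm{SL}_n(\mathbb C),\mathrm{SO}_n(\mathbb C))$ (symmetric pair of type AI), and let $P=P_S\subset G$ be a parabolic subgroup with $S\subset\{\alpha_1,\dots,\alpha_{n-1}\}$ in the notation of the context and $Q\subset K$ a parabolic subgroup. The double flag variety $K/Q\times G/P$ has finitely many $K$-orbits (for the diagonal action) in each of the following cases: (a) $S=\{\alpha_i\}$ for any $i$, and $Q$ is any parabolic subgroup of $K$; (b) $n=2m$ is even, $S=\{\alpha_i,\alpha_j\}$ for any $i,j$, and $Q=Q_{\{\beta_{m-1}\}}$ or $Q=Q_{\{\beta_m\}}$, i.e. $Q$ is the stabilizer in $\mathrm{SO}_{2m}$ of a Lagrangian subspace (belonging to either of the two families).
   Context: $\mathrm{SO}_n\subset\mathrm{SL}_n$ is the special orthogonal group of a nondegenerate symmetric bilinear form on $\mathbb C^n$. For $S=\{\alpha_{i_1},\dots,\alpha_{i_k}\}$ with $i_1<\dots<i_k$, $P_S\subset\mathrm{SL}_n$ is the stabilizer of a flag of subspaces of dimensions $i_1<\dots<i_k$; i.e. $S=\Pi\setminus J$ is the complement of the set of simple roots generating the Levi part. A Lagrangian subspace of $\mathbb C^{2m}$ is a totally isotropic subspace of dimension $m$; $\beta_{m-1},\beta_m$ denote the two end nodes of the fork of the Dynkin diagram $D_m$. *)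

(* Defs.v *)
From HB Require Import structures.
From mathcomp Require Import all_boot all_order all_algebra.
From mathcomp Require Import boolp classical_sets functions cardinality reals.
From mathcomp Require Import complex mpoly.

Set Implicit Arguments.
Unset Strict Implicit.
Unset Printing Implicit Defensive.

Import GRing.Theory.
Local Open Scope classical_set_scope.
Local Open Scope ring_scope.

Section Groups.

Variables (F : fieldType) (n : nat).
Implicit Types (g x y : 'M[F]_n) (G H K P Q N Z : set 'M[F]_n).

Definition SL : set 'M[F]_n := [set g | \det g = 1].

(* The bilinear form is given by its Gram matrix B: b(u, v) = u^T B v on
   column vectors. *)
Definition SO (B : 'M[F]_n) : set 'M[F]_n :=
  [set g | g^T *m B *m g = B /\ \det g = 1].

Definition is_subgroup H : Prop :=
  [/\ forall x, H x -> x \in unitmx,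
      H 1%:M,
      forall x y, H x -> H y -> H (x *m y)
    & forall x, H x -> H (invmx x)].

Definition derived H : set 'M[F]_n :=
  smallest is_subgroup
    [set g | exists x y, [/\ H x, H y &
       g = x *m y *m invmx x *m invmx y]].

Definition is_solvable H : Prop :=
  exists k, iter k derived H = [set 1%:M].

(* Polynomials in the n * n matrix entries, listed by mxvec. *)
Definition zariski_closed Z : Prop :=
  exists I : set {mpoly F[n * n]},
    Z = [set g | forall p, I p -> p.@[fun k => mxvec g ord0 k] = 0].

Definition zariski_connected H : Prop :=
  forall Z1 Z2, zariski_closed Z1 -> zariski_closed Z2 ->
    H `<=` Z1 `|` Z2 -> H `&` Z1 !=set0 -> H `&` Z2 !=set0 ->
    H `&` Z1 `&` Z2 !=set0.

Definition is_closed_subgroup K H : Prop :=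
  [/\ is_subgroup H, H `<=` K & zariski_closed H].

Definition is_borel K H : Prop :=
  let csc N := [/\ is_closed_subgroup K N, zariski_connected N
                 & is_solvable N] in
  csc H /\ forall N, csc N -> H `<=` N -> N = H.

(* K is meant to be a connected algebraic group, as SO B is. *)
Definition is_parabolic K Q : Prop :=
  is_closed_subgroup K Q /\ exists2 H, is_borel K H & H `<=` Q.

Definition translate g (A : set 'M[F]_n) : set 'M[F]_n :=
  [set g *m a | a in A].

Definition coset_space G H : set (set 'M[F]_n) :=
  [set translate g H | g in G].

Definition double_flag_variety G K P Q : set (set 'M[F]_n * set 'M[F]_n) :=
  coset_space K Q `*` coset_space G P.

Definition diagonal_orbit K (x : set 'M[F]_n * set 'M[F]_n) :=
  [set (translate k x.1, translate k x.2) | k in K].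

Definition finite_type G K P Q : Prop :=
  finite_set [set diagonal_orbit K x | x in double_flag_variety G K P Q].

Definition mxact g (U : {vspace 'cV[F]_n}) : {vspace 'cV[F]_n} :=
  (linfun (mulmx g) @: U)%VS.

(* The index k : 'I_n.-1 stands for the simple root alpha_(k+1), hence for the
   dimension k.+1 in 1, ..., n - 1. The values of V outside S play no role. *)
Definition is_flag (S : {set 'I_n.-1}) (V : 'I_n.-1 -> {vspace 'cV[F]_n}) :
    Prop :=
  (forall i, i \in S -> \dim (V i) = i.+1) /\
  (forall i j, i \in S -> j \in S -> (i <= j)%N -> (V i <= V j)%VS).

Definition is_parabolic_of_type (S : {set 'I_n.-1}) P : Prop :=
  exists2 V, is_flag S V &
    P = [set g | SL g /\ forall i, i \in S -> mxact g (V i) = V i].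

Definition is_lagrangian (B : 'M[F]_n) (L : {vspace 'cV[F]_n}) : Prop :=
  (2 * \dim L)%N = n /\
  forall u v, u \in L -> v \in L -> u^T *m B *m v = 0.

Definition is_lagrangian_stabilizer (B : 'M[F]_n) Q : Prop :=
  exists2 L, is_lagrangian B L & Q = [set g | SO B g /\ mxact g L = L].

End Groups.

Arguments SL {F n}.

(* Main.v *)
Require Import Defs.
From mathcomp Require Import all_boot all_order all_algebra.
From mathcomp Require Import boolp classical_sets functions cardinality reals.
From mathcomp Require Import complex mpoly.
From mathcomp Require Import zify ring.

Set Implicit Arguments.
Unset Strict Implicit.
Unset Printing Implicit Defensive.

Import GRing.Theory Num.Theory.
Local Open Scope classical_set_scope.
Local Open Scope ring_scope.

(** A K-orbit on K/Q x G/P is the K-class of a pair: a translate of the subspaces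
fixed by Q, and a translate of the flag fixed by P. Adding orthogonal complements,
such a pair becomes a configuration of subspaces that the form B carries to
itself. The finiteness is obtained in three steps.

First, only finitely many configurations exist up to GL_n. In the Grassmannian
case the parabolic Q contains a Borel subgroup, and the configuration is a full
flag together with a subspace W and its orthogonal, a star of type D. In the
Lagrangian case it is a subspace L with two two-step flags, W1 <= W2 and its
orthogonal, a star of type E6. Both types are finite, which is proved here by
hand: a configuration in positive dimension always has a direct summand of
dimension at most 3 from an explicit list ([dn_splits], [e6_splits]). By induction
some basis describes all subspaces by vectors with coordinates 0, 1 and -1
([class_adapted]), so finitely many codes are enough ([finite_codes]).

Second, if g carries one self-dual configuration to another, then g can be
replaced by an isometry ([isometry_of_selfdual]). Pulling back the form by g
changes it by a self-adjoint automorphism a of the first configuration; a square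
root of a that is a polynomial in a is again a self-adjoint automorphism, and it
corrects g. Isometries have determinant 1 or -1, and two isometries of
determinant -1 compose to one of determinant 1, so passing from the full isometry
group to SO costs a factor of at most 2 ([finite_image_code2]).

Third, Borel subgroups are defined as maximal closed connected solvable subgroups,
and the first step needs flags. By the Lie-Kolchin theorem ([lie_kolchin]) such a
group H fixes a full flag that is self-dual for B ([stable_flag]). The whole
stabilizer of this flag in SO is closed, connected and solvable, so by maximality
it is H ([borel_flag]). The only delicate point is connectedness: in a basis in
which B is antidiagonal, an element of the stabilizer is triangular, it is joined
to its diagonal part by a polynomial curve, and the diagonal part to 1 by a
rational one ([trigSO_to_1]).

Subspaces of column vectors are handled as row spaces of matrices, so g acts on the
right through its transpose. *)

(** * Direct summands of subspace configurations *)

Section Splitting.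
Variable F : fieldType.

Definition ann m n (X : 'M[F]_(m, n)) : 'M[F]_n := kermx X^T.

Lemma sub_annP r m n (Y : 'M[F]_(r, n)) (X : 'M_(m, n)) :
  reflect (Y *m X^T = 0) (Y <= ann X)%MS.
Proof. exact: sub_kermxP. Qed.

Lemma sub_annC r m n (Y : 'M[F]_(r, n)) (X : 'M_(m, n)) :
  (Y <= ann X)%MS = (X <= ann Y)%MS.
Proof.
by apply/sub_annP/sub_annP => h; apply: trmx_inj; rewrite trmx_mul trmxK h trmx0.
Qed.

Lemma annS m1 m2 n (X : 'M[F]_(m1, n)) (Y : 'M_(m2, n)) :
  (X <= Y)%MS -> (ann Y <= ann X)%MS.
Proof. by move=> h; rewrite sub_annC; apply: submx_trans h _; rewrite sub_annC. Qed.

Lemma rank_ann m n (X : 'M[F]_(m, n)) : \rank (ann X) = (n - \rank X)%N.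
Proof. by rewrite mxrank_ker mxrank_tr. Qed.

Lemma annK m n (X : 'M[F]_(m, n)) : (ann (ann X) :=: X)%MS.
Proof.
apply: eqmx_sym; apply/eqmxP; rewrite -(geq_leqif (mxrank_leqif_eq _)).
  by rewrite !rank_ann subKn // rank_leq_col.
by rewrite sub_annC.
Qed.

Lemma ann_leC m1 m2 n (X : 'M[F]_(m1, n)) (Y : 'M_(m2, n)) :
  (ann X <= ann Y)%MS = (Y <= X)%MS.
Proof. by rewrite sub_annC annK. Qed.

Definition signmx m n (A : 'M[F]_(m, n)) : Prop :=
  forall i j, A i j \in [:: 0; 1; -1].

(** The rows of p span a summand and the columns of f are the dual coordinates. The
matrix A spans, and C cuts out, the trace of X on the summand, both with
coefficients 0, 1 and -1; describing the trace twice makes the notion stable under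
taking annihilators. The conditions imply that X is stable under the projection
f *m p, hence is the sum of its traces on the summand and on the kernel of f. *)
Definition pattern k m n (p : 'M[F]_(k, n)) (f : 'M_(n, k)) (X : 'M_(m, n)) :=
  exists r s (A : 'M[F]_(r, k)) (C : 'M[F]_(s, k)),
    [/\ signmx A, signmx C, (A *m p <= X)%MS, X *m f *m C^T = 0
      & (ann C <= A)%MS].

Definition splits (T : Type) m n (X : T -> 'M[F]_(m, n)) : Prop :=
  exists k (p : 'M[F]_(k, n)) (f : 'M_(n, k)),
    [/\ (0 < k)%N, p *m f = 1%:M & forall t, pattern p f (X t)].

(** Transposition exchanges the summand with its dual and the two descriptions A and
C of the trace. *)
Lemma pattern_ann k m n (p : 'M[F]_(k, n)) (f : 'M_(n, k)) (X : 'M_(m, n)) :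
  pattern p f (ann X) -> pattern f^T p^T X.
Proof.
case=> r [s [A [C [sA sC pA fC leCA]]]]; exists s, r, C, A; split=> //.
- rewrite -(annK X) sub_annC; apply/sub_annP.
  by rewrite trmx_mul trmxK mulmxA.
- move: pA; rewrite sub_annC => /sub_annP.
  by rewrite trmx_mul mulmxA.
- by rewrite -(annK C) ann_leC.
Qed.

(** Half of the case distinctions for E6 are dual to the other half; this lemma
removes them. *)
Lemma splits_ann T m n (X : T -> 'M[F]_(m, n)) :
  splits (fun t => ann (X t)) -> splits X.
Proof.
case=> k [p [f [k0 pf h]]]; exists k, f^T, p^T; split=> //.
  by rewrite -trmx_mul pf trmx1.
by move=> t; apply: pattern_ann.
Qed.

Lemma splits_comp T T' (s : T' -> T) m n (X : T -> 'M[F]_(m, n)) :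
  splits X -> splits (fun t => X (s t)).
Proof. by case=> k [p [f [k0 pf h]]]; exists k, p, f; split. Qed.

Lemma sign01 (b : bool) : b%:R \in [:: 0; 1; -1 : F].
Proof. by case: b; rewrite !inE eqxx ?orbT. Qed.

Lemma pattern_coord (J : pred nat) k m n (p : 'M[F]_(k, n)) (f : 'M_(n, k))
    (X : 'M_(m, n)) :
  (forall i : 'I_k, J i -> (row i p <= X)%MS) ->
  (forall i : 'I_k, ~~ J i -> X *m col i f = 0) -> pattern p f X.
Proof.
move=> hp hf.
have E (b : pred nat) r (M : 'M[F]_(k, r)) i :
  row i (diag_mx (\row_(l < k) (b l)%:R) *m M) = (b i)%:R *: row i M.
  apply/rowP=> j; rewrite mxE mul_diag_mx !mxE //.
have sgn (b : pred nat) : signmx (diag_mx (\row_(l < k) (b l)%:R) : 'M[F]_k).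
  move=> i j; rewrite !mxE; case: eqP => _ /=; rewrite ?mulr1n ?mulr0n ?sign01 //.
  by rewrite inE eqxx.
exists k, k, (diag_mx (\row_(l < k) (J l)%:R)),
  (diag_mx (\row_(l < k) (predC J l)%:R)); split=> //.
- apply/row_subP=> i; rewrite E; case: (boolP (J i)) => h.
    by rewrite scale1r hp.
  by rewrite scale0r sub0mx.
- apply: trmx_inj; rewrite trmx_mul trmxK trmx0; apply/row_matrixP=> i.
  rewrite E row0 /=; case: (boolP (J i)) => h; first by rewrite scale0r.
  by rewrite -tr_col colE -mulmxA -colE hf // trmx0 scaler0.
- apply/rV_subP=> x /sub_annP; rewrite tr_diag_mx => hx.
  have {}hx (i : 'I_k) : (predC J i)%:R * x 0 i = 0.
    by move/rowP: hx => /(_ i); rewrite mul_mx_diag !mxE mulrC.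
  apply/submxP; exists x; rewrite mul_mx_diag; apply/rowP=> i; rewrite !mxE.
  move: (hx i) => /=; case: (J i) => /=; first by rewrite mulr1.
  by rewrite mul1r => ->; rewrite mul0r.
Qed.

(** The only trace that is not spanned by basis vectors: the hyperplane of vectors
with coordinate sum zero. *)
Lemma pattern_sum0 k m n (p : 'M[F]_(k.+1, n)) (f : 'M_(n, k.+1))
    (X : 'M_(m, n)) :
  (forall i, (row 0 p - row i p <= X)%MS) -> X *m (\sum_i col i f) = 0 ->
  pattern p f X.
Proof.
move=> hp hf.
exists k.+1, 1%N, (\matrix_(i, j) ((j == 0)%:R - (j == i)%:R)), (const_mx 1); split.
- move=> i j; rewrite !mxE !inE.
  by case: (j == 0); case: (j == i); rewrite ?subrr ?subr0 ?sub0r ?eqxx ?orbT.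
- by move=> i j; rewrite mxE !inE eqxx orbT.
- apply/row_subP=> i; rewrite row_mul.
  suff -> : row i (\matrix_(i, j) ((j == 0)%:R - (j == i)%:R)) *m p = row 0 p - row i p by [].
  rewrite [row 0 p]rowE [row i p]rowE -mulmxBl; congr (_ *m p).
  by apply/rowP=> j; rewrite !mxE eqxx /=.
- rewrite -mulmxA -[RHS]hf; congr (_ *m _).
  apply/colP=> i; rewrite !mxE summxE; apply: eq_bigr=> j _; by rewrite !mxE mulr1.
- apply/rV_subP=> x /sub_annP /matrixP /(_ 0 0); rewrite !mxE => hx.
  have {}hx : \sum_j x 0 j = 0.
    by rewrite -[RHS]hx; apply: eq_bigr=> j _; rewrite !mxE mulr1.
  apply/submxP; exists (- x); apply/rowP=> j; rewrite !mxE.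
  under eq_bigr => i _ do rewrite !mxE mulrBr.
  rewrite sumrB -mulr_suml sumrN hx oppr0 mul0r sub0r (bigD1 j) //= big1 ?eqxx.
    by rewrite addr0 mulr1 opprK.
  by move=> i /negPf h; rewrite eq_sym h mulr0.
Qed.


Lemma separate m n (w : 'rV[F]_n) (A : 'M_(m, n)) :
  ~~ (w <= A)%MS -> exists th : 'cV[F]_n, A *m th = 0 /\ w *m th = 1%:M.
Proof.
rewrite submxE; set M := w *m _ => /rV0Pn [j hj].
exists ((M 0 j)^-1 *: col j (cokermx A)); split.
  by rewrite -scalemxAr colE (mulmxA A) mulmx_coker mul0mx scaler0.
rewrite -scalemxAr colE (mulmxA w) -colE -/M; apply/matrixP=> i i'.
by rewrite !ord1 [LHS]mxE [col _ _ _ _]mxE mulVf // mxE.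
Qed.

(** Two linear functionals that agree on the intersection of two subspaces have a
common extension. *)
Lemma glue m1 m2 n (A : 'M[F]_(m1, n)) (B : 'M_(m2, n)) (a b : 'cV[F]_n) :
  (A :&: B)%MS *m (a - b) = 0 ->
  exists f : 'cV[F]_n, A *m f = A *m a /\ B *m f = B *m b.
Proof.
move=> h; pose D := (B :\: A)%MS.
have DA : (D :&: <<A>>)%MS = 0.
  by apply/eqP; rewrite -submx0 (cap_eqmx (eqmx_refl _) (genmxE A)) capmx_diff.
have [pr [pr0 pr1]] : exists pr : 'M[F]_n,
    (forall r (Y : 'M_(r, n)), (Y <= A)%MS -> Y *m pr = 0) /\ D *m pr = D.
  exists (proj_mx D <<A>>%MS); split; last by apply: proj_mx_id.
  by move=> r Y hY; apply: proj_mx_0; rewrite ?genmxE.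
exists (a + pr *m (b - a)); split.
  by rewrite mulmxDr mulmxA pr0 // mul0mx addr0.
have /sub_addsmxP [[u v] /= hB] : (B <= D + B :&: A)%MS.
  by rewrite addsmx_diff_cap_eq.
suff: B *m (a + pr *m (b - a) - b) = 0.
  by rewrite mulmxBr => /subr0_eq.
rewrite {1}hB mulmxDl -!mulmxA.
have -> : (B :&: A)%MS *m (a + pr *m (b - a) - b) = 0.
  rewrite mulmxBr mulmxDr mulmxA pr0 ?capmxSr // mul0mx addr0 -mulmxBr.
  have /submxP [z ->] : (B :&: A <= A :&: B)%MS by rewrite sub_capmx capmxSr capmxSl.
  by rewrite -mulmxA h mulmx0.
suff -> : D *m (a + pr *m (b - a) - b) = 0 by rewrite !mulmx0 addr0.
by rewrite !(mulmxDr, mulmxN) !mulmxA pr1 [D *m a + _]addrC subrK subrr.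
Qed.


Lemma splits_intro k T m n (X : T -> 'M[F]_(m, n))
    (ps : nat -> 'rV_n) (fs : nat -> 'cV_n) :
  (forall i j : 'I_k.+1, ps i *m fs j = (i == j)%:R%:M) ->
  (forall t, (exists J : pred nat,
      (forall i : 'I_k.+1, J i -> (ps i <= X t)%MS) /\
      (forall i : 'I_k.+1, ~~ J i -> X t *m fs i = 0)) \/
    ((forall i : 'I_k.+1, (ps 0%N - ps i <= X t)%MS) /\
     X t *m (\sum_(i < k.+1) fs i) = 0)) ->
  splits X.
Proof.
move=> dual h; pose p : 'M[F]_(k.+1, n) := \matrix_(i < k.+1) ps i.
pose f : 'M[F]_(n, k.+1) := \matrix_(i < n, j < k.+1) fs j i 0.
have pE (i : 'I_k.+1) : row i p = ps i by rewrite rowK.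
have fE (i : 'I_k.+1) : col i f = fs i by apply/colP=> j; rewrite !mxE.
exists k.+1, p, f; split=> //.
  apply/matrixP=> i j; have := dual i j.
  rewrite -pE -fE -row_mul colE mulmxA -colE => /matrixP /(_ 0 0).
  by rewrite !mxE eqxx mulr1n.
move=> t; case: (h t) => [[J [hp hf]]|[hp hf]].
  by apply: (@pattern_coord J) => i Ji; rewrite ?pE ?fE; [apply: hp|apply: hf].
apply: pattern_sum0; first by move=> i; rewrite !pE.
by rewrite (eq_bigr _ (fun i _ => fE i)).
Qed.

(** A vector of A outside C spans a one-dimensional summand: a functional that
vanishes on C and takes value 1 on the vector vanishes on every X t that does not
contain it. *)
Lemma nosplit_le T m r s n (X : T -> 'M[F]_(m, n)) (A : 'M_(r, n)) (C : 'M_(s, n)) :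
  ~ splits X -> (forall t, (A <= X t)%MS \/ (X t <= C)%MS) -> (A <= C)%MS.
Proof.
move=> ns h; apply/row_subP=> i; apply/negP => /negP /separate [th [C0 v1]].
apply: ns; apply: (@splits_intro 0 _ _ _ X (fun=> row i A) (fun=> th)).
  by move=> a b; rewrite !ord1 v1.
move=> t; left; case: (h t) => ht; [exists predT|exists pred0]; split=> // a _.
  exact: submx_trans (row_sub _ _) ht.
by have /submxP [z ->] := ht; rewrite -mulmxA C0 mulmx0.
Qed.

Lemma sub0mul r m n (A : 'M[F]_(r, n)) (B : 'M_(m, n)) (th : 'cV_n) :
  (A <= B)%MS -> B *m th = 0 -> A *m th = 0.
Proof. by case/submxP=> z -> h; rewrite -mulmxA h mulmx0. Qed.

Lemma sub_eqmul r m n (A : 'M[F]_(r, n)) (B : 'M_(m, n)) (a b : 'cV_n) :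
  (A <= B)%MS -> B *m a = B *m b -> A *m a = A *m b.
Proof. by case/submxP=> z -> h; rewrite -!mulmxA h. Qed.

(** The E6 star: the centre is the ambient space, the arms are L, W1 <= W2 and
U1 <= U2. *)
Definition e6_config m n (L W1 W2 U1 U2 : 'M[F]_(m, n)) (t : option (bool * bool)) :=
  match t with
  | None => L
  | Some (false, b) => if b then W2 else W1
  | Some (true, b) => if b then U2 else U1
  end.

Lemma e6_config_sym m n (L W1 W2 U1 U2 : 'M[F]_(m, n)) :
  splits (e6_config L U1 U2 W1 W2) -> splits (e6_config L W1 W2 U1 U2).
Proof.
move=> /(splits_comp (fun t : option (bool * bool) =>
  if t is Some (a, b) then Some (~~ a, b) else None)).
case=> k [p [f [k0 pf h]]]; exists k, p, f; split=> // t.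
by move: (h t); case: t => [[[] b]|].
Qed.


(** The summand is the plane with basis w, u and dual basis phi, th - phi; the
vector w - u has coordinate sum zero, and th is the sum of the coordinates. *)
Lemma splits2 T m n (X : T -> 'M[F]_(m, n)) (w u : 'rV_n) (phi th : 'cV_n) :
  w *m phi = 1%:M -> w *m th = 1%:M -> u *m phi = 0 -> u *m th = 1%:M ->
  (forall t, [\/ X t *m phi = 0 /\ X t *m th = 0,
     (w <= X t)%MS /\ X t *m phi = X t *m th,
     (u <= X t)%MS /\ X t *m phi = 0 |
     (w <= X t)%MS /\ (u <= X t)%MS \/
     (w - u <= X t)%MS /\ X t *m th = 0]) ->
  splits X.
Proof.
move=> wp wt up ut h.
apply: (@splits_intro 1 _ _ _ X (nth 0 [:: w; u]) (nth 0 [:: phi; th - phi])).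
  case=> [[|[|//]] ?]; case=> [[|[|//]] ?]; rewrite /= ?mulmxBr ?wp ?wt ?up ?ut //.
  - by rewrite subrr raddf0.
  - by rewrite raddf0.
  - by rewrite subr0.
move=> t; case: (h t) => [[h1 h2]|[h1 h2]|[h1 h2]|[[h1 h2]|[h1 h2]]].
- left; exists pred0; split=> // -[[|[|//]] ?] _ //=.
  by rewrite mulmxBr h1 h2 subrr.
- left; exists (pred1 0%N); split=> -[[|[|//]] ?] //= _.
  by rewrite mulmxBr h2 subrr.
- left; exists (pred1 1%N); split=> -[[|[|//]] ?] //= _.
- by left; exists predT; split=> -[[|[|//]] ?].
- right; split; last by rewrite !big_ord_recl big_ord0 /= addr0 addrC subrK.
  by case=> [[|[|//]] ?] //=; rewrite subrr sub0mx.
Qed.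


(** The following lemmas show, step by step, that an E6 configuration with no
summand lives in dimension 0. *)
Definition nonsplit6 m n (L W1 W2 U1 U2 : 'M[F]_(m, n)) : Prop :=
  [/\ (W1 <= W2)%MS, (U1 <= U2)%MS & ~ splits (e6_config L W1 W2 U1 U2)].

Lemma nonsplit6_sym m n (L W1 W2 U1 U2 : 'M[F]_(m, n)) :
  nonsplit6 L W1 W2 U1 U2 -> nonsplit6 L U1 U2 W1 W2.
Proof. by case=> hW hU ns; split=> // /e6_config_sym. Qed.

Lemma nonsplit6_ann m n (L W1 W2 U1 U2 : 'M[F]_(m, n)) :
  nonsplit6 L W1 W2 U1 U2 ->
  nonsplit6 (ann L) (ann W2) (ann W1) (ann U2) (ann U1).
Proof.
case=> hW hU ns; split; rewrite ?ann_leC // => sp; apply: ns; apply: splits_ann.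
move: sp => /(splits_comp (fun t : option (bool * bool) =>
  if t is Some (a, b) then Some (a, ~~ b) else None)).
case=> k [p [f [k0 pf h]]]; exists k, p, f; split=> // t.
by move: (h t); case: t => [[[] []]|].
Qed.

Ltac e6_incl := solve [assumption | apply: submx_refl
  | match goal with H : is_true (?A <= _)%MS |- is_true (?A <= _)%MS =>
      apply: (submx_trans H); solve [assumption | exact: addsmxSl | exact: addsmxSr] end
  | exact: addsmxSl | exact: addsmxSr | exact: sub0mx].
Ltac one_dim ns := apply: (nosplit_le ns) => -[[[] []]|] /=;
  solve [left; e6_incl | right; e6_incl].

(** Successive uses of [nosplit_le] confine x to more and more members, until all
five contain it. *)
Lemma nonsplit6_LW1 m n (L W1 W2 U1 U2 : 'M[F]_(m, n)) (x : 'rV_n) :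
  nonsplit6 L W1 W2 U1 U2 -> (x <= L)%MS -> (x <= W1)%MS -> x = 0.
Proof.
case=> hW hU ns xL xW; have xU2 : (x <= U2)%MS by one_dim ns.
have xU1 : (x <= U1)%MS by one_dim ns.
by apply/eqP; rewrite -submx0; one_dim ns.
Qed.

Lemma nonsplit6_W1U1 m n (L W1 W2 U1 U2 : 'M[F]_(m, n)) (x : 'rV_n) :
  nonsplit6 L W1 W2 U1 U2 -> (x <= W1)%MS -> (x <= U1)%MS -> x = 0.
Proof.
move=> ns6 xW xU; apply: (nonsplit6_LW1 ns6) => //; case: ns6 => hW hU ns.
by one_dim ns.
Qed.

Lemma sub_addsmx_rV r s n (x : 'rV[F]_n) (A : 'M_(r, n)) (B : 'M_(s, n)) :
  (x <= A + B)%MS -> exists a b : 'rV_n, [/\ (a <= A)%MS, (b <= B)%MS & x = a + b].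
Proof.
by case/sub_addsmxP=> -[a b] /= ->; exists (a *m A), (b *m B); rewrite !submxMl.
Qed.

Lemma glue0 r s n (A : 'M[F]_(r, n)) (B : 'M_(s, n)) (th : 'cV_n) :
  (forall x : 'rV_n, (x <= A)%MS -> (x <= B)%MS -> x *m th = 0) ->
  exists f : 'cV[F]_n, A *m f = A *m th /\ B *m f = 0.
Proof.
move=> h; have [|f []] := @glue _ _ _ A B th 0.
  rewrite subr0; apply/row_matrixP=> i; rewrite row_mul row0.
  by apply: h; apply: submx_trans (row_sub _ _) _; rewrite ?capmxSl ?capmxSr.
by rewrite mulmx0 => hA hB; exists f.
Qed.

(** If w were nonzero, w and u would span a plane in which W1 and U1 are two
coordinate lines, L is a third line, and W2 and U2 are the whole plane. *)
Lemma nonsplit6_cross m n (L W1 W2 U1 U2 : 'M[F]_(m, n)) (w u : 'rV_n) :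
  nonsplit6 L W1 W2 U1 U2 -> (w <= W1)%MS -> (w <= U2)%MS ->
  (u <= W2)%MS -> (u <= U1)%MS -> (w - u <= L)%MS -> w = 0.
Proof.
move=> ns6 wW wU uW uU vL; apply: (nonsplit6_LW1 ns6) => //.
case: (boolP (w <= L)%MS) => // /separate [th [Lt wt]].
have [f [Wf Uf]] : exists f : 'cV[F]_n, W1 *m f = W1 *m th /\ U1 *m f = 0.
  by apply: glue0 => x xW xU; rewrite (nonsplit6_W1U1 ns6 xW xU) mul0mx.
case: ns6 => hW hU []; have wf : w *m f = 1%:M by rewrite (sub_eqmul wW Wf).
have uf : u *m f = 0 by rewrite (sub0mul uU Uf).
apply: (splits2 (w := w) (u := u) wf wt uf).
  apply/eqP; rewrite -subr_eq0 -wt -opprB oppr_eq0 -mulmxBl; apply/eqP.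
  exact: sub0mul vL Lt.
move=> [[[] []]|] /=.
- by apply: Or44; left; split=> //; apply: submx_trans hU.
- by apply: Or43.
- by apply: Or44; left; split=> //; apply: submx_trans hW.
- by apply: Or42.
- by apply: Or44; right.
Qed.

(** The same plane as in [nonsplit6_cross], except that W2 meets it in the line of w
only. The functional th can be chosen unless w lies in L + (W2 :&: U1), the case
that [nonsplit6_cross] excludes. *)
Lemma nonsplit6_W1U2 m n (L W1 W2 U1 U2 : 'M[F]_(m, n)) (w : 'rV_n) :
  nonsplit6 L W1 W2 U1 U2 -> (w <= W1)%MS -> (w <= U2)%MS -> w = 0.
Proof.
move=> ns6 wW1 wU2; have [hW hU ns] := ns6.
have wW2 := submx_trans wW1 hW.
have /sub_addsmx_rV [v [u [vL uU1 wvu]]] : (w <= L + U1)%MS by one_dim ns.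
have vE : v = w - u by rewrite wvu addrK.
case: (boolP (w <= L + (W2 :&: U1))%MS) => [|].
  case/sub_addsmx_rV=> l [u' [lL]]; rewrite sub_capmx => /andP [u'W u'U] wE.
  by apply: (nonsplit6_cross (u := u') ns6) => //; rewrite wE addrK.
case/separate=> th [th0 wt].
have Lt : L *m th = 0 by apply: sub0mul th0; apply: addsmxSl.
have Ct : (W2 :&: U1)%MS *m th = 0 by apply: sub0mul th0; apply: addsmxSr.
have [f [Wf Uf]] : exists f : 'cV[F]_n, W2 *m f = W2 *m th /\ U1 *m f = 0.
  by apply: glue0 => x xW xU; apply: sub0mul Ct; rewrite sub_capmx xW.
have wf : w *m f = 1%:M by rewrite (sub_eqmul wW2 Wf).
have uf : u *m f = 0 by rewrite (sub0mul uU1 Uf).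
case: ns.
apply: (splits2 (w := w) (u := u) wf wt uf).
  apply/eqP; rewrite -subr_eq0 -wt -opprB oppr_eq0 -mulmxBl -vE; apply/eqP.
  exact: sub0mul vL Lt.
move=> [[[] []]|] /=.
- by apply: Or44; left; split=> //; apply: submx_trans hU.
- by apply: Or43.
- by apply: Or42.
- by apply: Or42; split=> //; apply: sub_eqmul Wf.
- by apply: Or44; right; rewrite -vE.
Qed.

(** This is [nonsplit6_W1U2] for the dual configuration. *)
Lemma nonsplit6_W1U2_full m n (L W1 W2 U1 U2 : 'M[F]_(m, n)) :
  nonsplit6 L W1 W2 U1 U2 -> (1%:M <= W1 + U2)%MS.
Proof.
move=> ns6; rewrite -ann_leC; apply/rV_subP=> x xA.
suff -> : x = 0 by rewrite sub0mx.
apply: (nonsplit6_W1U2 (nonsplit6_sym (nonsplit6_ann ns6))); apply: submx_trans xA _.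
  by apply: annS; exact: addsmxSr.
by apply: annS; exact: addsmxSl.
Qed.

(** Otherwise x would span, with the component of x in U1, a plane in which W1 is
zero, W2 is the line of x, U1 another line, and U2 the whole plane. *)
Lemma nonsplit6_middle_sub m n (L W1 W2 U1 U2 : 'M[F]_(m, n)) (x : 'rV_n) :
  nonsplit6 L W1 W2 U1 U2 -> (x <= W2)%MS -> (x <= U2)%MS ->
  (x <= L + U1)%MS -> (x <= L + W1)%MS.
Proof.
move=> ns6 xW xU; have [hW hU ns] := ns6.
case/sub_addsmx_rV=> v [u [vL uU1 xvu]].
have vE : v = x - u by rewrite xvu addrK.
case: (boolP (x <= L + W1)%MS) => // /separate [th [th0 xt]].
have Lt : L *m th = 0 by apply: sub0mul th0; apply: addsmxSl.
have Wt : W1 *m th = 0 by apply: sub0mul th0; apply: addsmxSr.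
have [f [Wf Uf]] : exists f : 'cV[F]_n, W2 *m f = W2 *m th /\ U1 *m f = 0.
  apply: glue0 => y yW yU.
  by rewrite (nonsplit6_W1U2 (nonsplit6_sym ns6) yU yW) mul0mx.
have xf : x *m f = 1%:M by rewrite (sub_eqmul xW Wf).
have uf : u *m f = 0 by rewrite (sub0mul uU1 Uf).
case: ns; apply: (splits2 (w := x) (u := u) xf xt uf).
  apply/eqP; rewrite -subr_eq0 -xt -opprB oppr_eq0 -mulmxBl -vE; apply/eqP.
  exact: sub0mul vL Lt.
move=> [[[] []]|] /=.
- by apply: Or44; left; split=> //; apply: submx_trans hU.
- by apply: Or43.
- by apply: Or42.
- by apply: Or41; rewrite (sub_eqmul hW Wf).
- by apply: Or44; right; rewrite -vE.
Qed.

(** A nonzero x would belong to the three-dimensional summand with basis x, u, w in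
which W1 and W2 are spanned by w and by w, x, likewise U1 and U2 by u and by u, x,
and L is the plane of coordinate sum zero; here x - u and x - w lie in L. *)
Lemma nonsplit6_middle m n (L W1 W2 U1 U2 : 'M[F]_(m, n)) (x : 'rV_n) :
  nonsplit6 L W1 W2 U1 U2 -> (x <= W2)%MS -> (x <= U2)%MS ->
  (x <= L + U1)%MS -> x = 0.
Proof.
move=> ns6 xW xU xLU; have xLW := nonsplit6_middle_sub ns6 xW xU xLU.
have [hW hU ns] := ns6.
case: (boolP (x <= L)%MS) => [xL|].
  have : (x <= W1 + U1)%MS by one_dim ns.
  case/sub_addsmx_rV=> w [u [wW uU xE]].
  have w0 : w = 0.
    apply: (nonsplit6_W1U2 ns6) => //.
    have -> : w = x - u by rewrite xE addrK.
    by apply: addmx_sub; rewrite ?eqmx_opp // (submx_trans uU).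
  apply: (nonsplit6_W1U2 (nonsplit6_sym ns6) _ xW).
  by rewrite xE w0 add0r.
case/separate=> th [Lt xt].
have [l [u [lL uU xlu]]] := sub_addsmx_rV xLU.
have [l' [w [lL' wW xlw]]] := sub_addsmx_rV xLW.
have lE : l = x - u by rewrite xlu addrK.
have lE' : l' = x - w by rewrite xlw addrK.
have [fu [Ufu Wfu]] : exists f : 'cV[F]_n, U1 *m f = U1 *m th /\ W2 *m f = 0.
  by apply: glue0 => y yU yW; rewrite (nonsplit6_W1U2 (nonsplit6_sym ns6) yU yW) mul0mx.
have [fw [Wfw Ufw]] : exists f : 'cV[F]_n, W1 *m f = W1 *m th /\ U2 *m f = 0.
  by apply: glue0 => y yW yU; rewrite (nonsplit6_W1U2 ns6 yW yU) mul0mx.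
have xfu : x *m fu = 0 by apply: sub0mul Wfu.
have xfw : x *m fw = 0 by apply: sub0mul Ufw.
have W1fu : W1 *m fu = 0 by apply: sub0mul Wfu.
have U1fw : U1 *m fw = 0 by apply: sub0mul Ufw.
have ut : u *m th = 1%:M.
  apply/eqP; rewrite -subr_eq0 -xt -opprB oppr_eq0 -mulmxBl -lE; apply/eqP.
  exact: sub0mul lL Lt.
have wt : w *m th = 1%:M.
  apply/eqP; rewrite -subr_eq0 -xt -opprB oppr_eq0 -mulmxBl -lE'; apply/eqP.
  exact: sub0mul lL' Lt.
have ufu : u *m fu = 1%:M by rewrite (sub_eqmul uU Ufu).
have wfw : w *m fw = 1%:M by rewrite (sub_eqmul wW Wfw).
have ufw : u *m fw = 0 by apply: sub0mul U1fw.
have wfu : w *m fu = 0 by apply: sub0mul W1fu.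
case: ns.
apply: (@splits_intro 2 _ _ _ _ (nth 0 [:: x; u; w]) (nth 0 [:: th - fu - fw; fu; fw])).
  case=> [[|[|[|//]]] ?]; case=> [[|[|[|//]]] ?]; rewrite /= ?mulmxBr;
    by rewrite ?(xt, xfu, xfw, ut, ufu, ufw, wt, wfu, wfw, subrr, subr0, raddf0).
move=> [[[] []]|] /=.
- left; exists (fun i => i < 2)%N; split=> -[[|[|[|//]]] ?] //= _.
  exact: submx_trans hU.
- left; exists (pred1 1%N); split=> -[[|[|[|//]]] ?] //= _.
  by rewrite !mulmxBr Ufu U1fw subrr subr0.
- left; exists (fun i => i != 1)%N; split=> -[[|[|[|//]]] ?] //= _.
  exact: submx_trans hW.
- left; exists (pred1 2%N); split=> -[[|[|[|//]]] ?] //= _.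
  by rewrite !mulmxBr Wfw W1fu subr0 subrr.
- right; split; last first.
    rewrite !big_ord_recl big_ord0 /= addr0 -Lt; congr (L *m _).
    by rewrite addrA addrAC !subrK.
  by case=> [[|[|[|//]]] ?] /=; rewrite ?subrr ?sub0mx -?lE -?lE'.
Qed.

(** A dimension count: W2 :&: U2 and L + U1 are independent, and both ranks are known
because the ambient space is the direct sum of W2 and U1. *)
Lemma nonsplit6_rank m n (L W1 W2 U1 U2 : 'M[F]_(m, n)) :
  nonsplit6 L W1 W2 U1 U2 -> (\rank L + \rank U2 <= n)%N.
Proof.
move=> ns6; have [hW hU ns] := ns6.
have d0 r s (A : 'M[F]_(r, n)) (B : 'M_(s, n)) :
    (forall x : 'rV_n, (x <= A)%MS -> (x <= B)%MS -> x = 0) ->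
    \rank (A + B)%MS = (\rank A + \rank B)%N.
  move=> h; rewrite -(mxrank_sum_cap A B) -[LHS]addn0; congr addn.
  apply/esym/eqP; rewrite mxrank_eq0; apply/eqP/row_matrixP=> i; rewrite row0.
  by apply: h; apply: submx_trans (row_sub _ _) _; rewrite ?capmxSl ?capmxSr.
have full r s (A : 'M[F]_(r, n)) (B : 'M_(s, n)) :
    (1%:M <= A + B)%MS -> \rank (A + B)%MS = n.
  by rewrite sub1mx => /eqP.
have e1 : (\rank W2 + \rank U1 = n)%N.
  rewrite -d0; last by move=> x xW xU; apply: (nonsplit6_W1U2 (nonsplit6_sym ns6)).
  by apply: full; rewrite addsmxC; apply: nonsplit6_W1U2_full (nonsplit6_sym ns6).
have e2 : (\rank (W2 :&: U2)%MS + n = \rank W2 + \rank U2)%N.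
  rewrite -(mxrank_sum_cap W2 U2) addnC full //.
  by apply: submx_trans (nonsplit6_W1U2_full ns6) _; apply: addsmxS.
have e3 : (\rank (L + U1)%MS = \rank L + \rank U1)%N.
  by apply: d0 => x xL xU; apply: (nonsplit6_LW1 (nonsplit6_sym ns6)).
have : (\rank (W2 :&: U2 + (L + U1)) <= n)%N by apply: rank_leq_col.
rewrite d0 ?e3; last first.
  by move=> x; rewrite sub_capmx => /andP [xW xU]; apply: (nonsplit6_middle ns6).
move: e1 e2; lia.
Qed.

(** [nonsplit6_rank] and its dual give rank L + rank U2 <= n <= rank L + rank U1, so
U1 = U2, and likewise W1 = W2. Then the space is the sum of W1 and U1, L is the
graph of an isomorphism between them, and any vector of L spans with its
components a plane that splits off. *)
Lemma e6_splits m n (L W1 W2 U1 U2 : 'M[F]_(m, n)) :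
  (0 < n)%N -> (W1 <= W2)%MS -> (U1 <= U2)%MS -> splits (e6_config L W1 W2 U1 U2).
Proof.
move=> n0 hW hU; apply: contrapT => ns.
have ns6 : nonsplit6 L W1 W2 U1 U2 by [].
have ns6' := nonsplit6_sym ns6.
have := nonsplit6_rank ns6; have := nonsplit6_rank (nonsplit6_ann ns6).
have := nonsplit6_rank ns6'; have := nonsplit6_rank (nonsplit6_ann ns6').
rewrite !rank_ann => r1 r2 r3 r4.
have rL := rank_leq_col L; have rU := rank_leq_col U1; have rW := rank_leq_col W1.
have eU : (U2 <= U1)%MS.
  rewrite -(geq_leqif (mxrank_leqif_sup hU)); move: r1 r2 r3 r4; lia.
have eW : (W2 <= W1)%MS.
  rewrite -(geq_leqif (mxrank_leqif_sup hW)); move: r1 r2 r3 r4; lia.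
have full : (1%:M <= W1 + U1)%MS.
  by apply: submx_trans (nonsplit6_W1U2_full ns6) _; rewrite addsmxS.
have [v vL v0] : exists2 v : 'rV_n, (v <= L)%MS & v != 0.
  case: (boolP (L == 0)) => [/eqP L0|/rowV0Pn [v vL v0]]; last by exists v.
  have nL : \rank L = 0%N by rewrite L0 mxrank0.
  have : (U1 <= (0 : 'M_n))%MS.
    apply/rV_subP=> x xU; suff -> : x = 0 by rewrite sub0mx.
    apply: (nonsplit6_W1U1 ns6) => //; apply: submx_trans (submx1 x) _.
    rewrite sub1mx /row_full eqn_leq rank_leq_col; move: r1 r2 r3 r4; lia.
  rewrite submx0 -mxrank_eq0; move: r1 r2 r3 r4 n0; lia.
have /sub_addsmx_rV [w [u [wW uU vE]]] := submx_trans (submx1 v) full.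
have /separate [th [Lt wt]] : ~~ (w <= L)%MS.
  apply/negP => wL; have w0 := nonsplit6_LW1 ns6 wL wW; move/eqP: v0; apply.
  by apply: (nonsplit6_LW1 ns6') => //; rewrite vE w0 add0r.
have [f [Wf Uf]] : exists f : 'cV[F]_n, W1 *m f = W1 *m th /\ U1 *m f = 0.
  by apply: glue0 => x xW xU; rewrite (nonsplit6_W1U1 ns6 xW xU) mul0mx.
have wf : w *m f = 1%:M by rewrite (sub_eqmul wW Wf).
have uf : - u *m f = 0 by rewrite mulNmx (sub0mul uU Uf) oppr0.
case: ns; apply: (splits2 (w := w) (u := - u) wf wt uf).
  rewrite -wt; apply/esym/eqP; rewrite -subr_eq0 -mulmxBl opprK -vE; apply/eqP.
  exact: sub0mul vL Lt.
have uU2 : (- u <= U1)%MS by rewrite eqmx_opp.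
move=> [[[] []]|] /=.
- by apply: Or43; split; [apply: submx_trans hU|apply: sub0mul Uf].
- by apply: Or43.
- by apply: Or42; split; [apply: submx_trans hW|apply: sub_eqmul Wf].
- by apply: Or42.
- by apply: Or44; right; rewrite opprK -vE.
Qed.

(** The D-type star: two subspaces and a chain of subspaces. *)
Definition dn_config m n (W W' : 'M[F]_(m, n)) (E : nat -> 'M[F]_(m, n)) (t : bool + nat) :=
  match t with inl b => if b then W' else W | inr i => E i end.

(** Without one-dimensional summands the space is the direct sum of W and W'. A vector
v of the first nonzero member of the chain has then nonzero components in both, and
the plane of these components splits off: a functional th that is 1 on the
W-component of v and vanishes on the last member E j not containing that component
makes the plane compatible with the whole chain. *)
Lemma dn_splits m n (W W' : 'M[F]_(m, n)) (E : nat -> 'M[F]_(m, n)) r :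
  (0 < n)%N -> E 0%N = 0 -> (1%:M <= E r)%MS ->
  (forall i j, (i <= j)%N -> (E i <= E j)%MS) -> splits (dn_config W W' E).
Proof.
move=> n0 E0 Er mono; apply: contrapT => ns.
(* Each member of the chain contains E i or is contained in the previous one. *)
have stepcase i j : ((i <= j) \/ (j <= i.-1))%N by lia.
(* The bounds below exclude one-dimensional summands, climbing the chain by
   induction. *)
have h1 i (x : 'rV_n) : (x <= W)%MS -> (x <= W')%MS -> (x <= E i)%MS -> x = 0.
  elim: i x => [|i IH] x xW xW' xE; first by move: xE; rewrite E0 => /submx0null.
  apply: IH => //; apply: (nosplit_le ns) => -[[]|j] /=; try by left.
  case: (stepcase i.+1 j) => /= h; [left|right]; last exact: mono.
  exact: submx_trans xE (mono _ _ h).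
have WW (x : 'rV_n) : (x <= W)%MS -> (x <= W')%MS -> x = 0.
  by move=> xW xW'; apply: (h1 r) => //; apply: submx_trans (submx1 x) Er.
have h2 i : (E i <= W + W')%MS.
  elim: i => [|i IH]; first by rewrite E0 sub0mx.
  suff h : (E i.+1 <= E i + W + W')%MS.
    apply: submx_trans h _; rewrite !addsmx_sub IH addsmxSl addsmxSr //.
  apply: (nosplit_le ns) => -[[]|j] /=.
  - by right; apply: addsmxSr.
  - by right; rewrite -addsmxA addsmxC -addsmxA addsmxSl.
  case: (stepcase i.+1 j) => /= h; [left|right]; first exact: mono.
  by rewrite -addsmxA (submx_trans (mono _ _ h)) // addsmxSl.
have full x : (x <= W + W')%MS.
  by apply: submx_trans (submx1 x) (submx_trans Er (h2 r)).
have h3 i (x : 'rV_n) : E i = 0 -> (x <= E i.+1)%MS -> (x <= W)%MS -> x = 0.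
  move=> Ei xE xW; apply: WW => //; apply: (nosplit_le ns) => -[[]|j] /=.
  - by right.
  - by left.
  case: (stepcase i.+1 j) => /= h; [left|right].
    exact: submx_trans xE (mono _ _ h).
  by apply: submx_trans (mono _ _ h) _; rewrite Ei sub0mx.
have h3' i (x : 'rV_n) : E i = 0 -> (x <= E i.+1)%MS -> (x <= W')%MS -> x = 0.
  move=> Ei xE xW; apply: WW => //; apply: (nosplit_le ns) => -[[]|j] /=.
  - by left.
  - by right.
  case: (stepcase i.+1 j) => /= h; [left|right].
    exact: submx_trans xE (mono _ _ h).
  by apply: submx_trans (mono _ _ h) _; rewrite Ei sub0mx.
have [i [Ei /rowV0Pn [v vE v0]]] : exists i, E i = 0 /\ E i.+1 != 0.
  have ex : exists i, E i != 0.
    exists r; apply/eqP => Er0; move: Er; rewrite Er0 sub1mx /row_full mxrank0; lia.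
  case: (ex_minnP ex) => -[|i] hi himin; first by rewrite E0 eqxx in hi.
  exists i; split=> //; apply/eqP; case: (boolP (E i == 0)) => // /himin; lia.
have /sub_addsmx_rV [w [u [wW uU vwu]]] := full _ v.
have w0 : w != 0.
  apply/eqP => w0; move/eqP: v0; apply; apply: (h3' i) => //.
  by rewrite vwu w0 add0r.
(* E j is the last member of the chain that does not contain w. *)
have [j [wj wj1]] : exists j, ~~ (w <= E j)%MS /\ (w <= E j.+1)%MS.
  have ex : exists i, (w <= E i)%MS.
    by exists r; apply: submx_trans (submx1 w) Er.
  case: (ex_minnP ex) => -[|j] hj hjmin.
    by move: hj w0; rewrite E0 => /submx0null ->; rewrite eqxx.
  exists j; split=> //; apply/negP => /hjmin; lia.
have ij : (i < j)%N.
  rewrite ltnNge; apply/negP => ji; move/eqP: w0; apply; apply: (h3 i) => //.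
  by apply: submx_trans wj1 (mono _ _ _).
have /separate [th [Et wt]] := wj.
have vt : v *m th = 0 by apply: sub0mul Et; apply: submx_trans vE (mono _ _ ij).
have [f [Wf Uf]] : exists f : 'cV[F]_n, W *m f = W *m th /\ W' *m f = 0.
  by apply: glue0 => x xW xU; rewrite (WW _ xW xU) mul0mx.
have wf : w *m f = 1%:M by rewrite (sub_eqmul wW Wf).
have uU' : (- u <= W')%MS by rewrite eqmx_opp.
have uf : - u *m f = 0 by apply: sub0mul Uf.
case: ns; apply: (splits2 (w := w) (u := - u) wf wt uf).
  by rewrite -wt; apply/esym/eqP; rewrite -subr_eq0 -mulmxBl opprK -vwu vt.
move=> [[]|k] /=.
- by apply: Or43.
- by apply: Or42.
have [ki|ik] := leqP k i.
  have Ek : E k = 0 by move: (mono _ _ ki); rewrite Ei => /submx0null.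
  by apply: Or41; rewrite Ek !mul0mx.
apply: Or44; have [kj|jk] := leqP k j.
  right; rewrite opprK -vwu; split; first exact: submx_trans vE (mono _ _ ik).
  by apply: sub0mul Et; apply: mono.
left; have wk := submx_trans wj1 (mono _ _ jk); split=> //.
rewrite eqmx_opp; have -> : u = v - w by rewrite vwu addrC addKr.
by apply: addmx_sub; rewrite ?eqmx_opp // (submx_trans vE (mono _ _ ik)).
Qed.

End Splitting.

(** * Finitely many configurations up to linear equivalence *)

Section Adapted.
Variable F : fieldType.

Definition adapted (T : Type) m n (X : T -> 'M[F]_(m, n)) : Prop :=
  exists2 g, g \in unitmx &
    forall t, exists r (A : 'M[F]_(r, n)), signmx A /\ (X t *m g :=: A)%MS.

Lemma resolution_orth k n n' (p : 'M[F]_(k, n)) (f : 'M_(n, k))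
    (q : 'M_(n', n)) (h : 'M_(n, n')) :
  p *m f = 1%:M -> q *m h = 1%:M -> f *m p + h *m q = 1%:M -> p *m h = 0.
Proof.
move=> pf qh e; have : p *m (f *m p + h *m q) *m h = p *m h by rewrite e mulmx1.
rewrite mulmxDr mulmxA pf mul1mx mulmxA mulmxDl -!mulmxA qh mulmx1.
by rewrite -[RHS]addr0 => /addrI.
Qed.

(** Bases of a summand and of its complement combine; the stability of every X t
under the projection makes the description block diagonal. *)
Lemma adapted_cat T m k n (X : T -> 'M[F]_(m, k + n))
    (p : 'M_(k, k + n)) (f : 'M_(k + n, k)) (q : 'M_(n, k + n)) (h : 'M_(k + n, n)) :
  p *m f = 1%:M -> q *m h = 1%:M -> f *m p + h *m q = 1%:M ->
  (forall t, pattern p f (X t)) -> adapted (fun t => X t *m h) -> adapted X.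
Proof.
move=> pf qh e pat [g gu hg].
have ph := resolution_orth pf qh e.
have qf : q *m f = 0 by apply: resolution_orth qh pf _; rewrite addrC.
exists (row_mx f (h *m g)).
  have : col_mx p (invmx g *m q) *m row_mx f (h *m g) = 1%:M.
    rewrite mul_col_row pf mulmxA ph mul0mx -mulmxA qf mulmx0 -mulmxA.
    by rewrite (mulmxA q) qh mul1mx mulVmx // scalar_mx_block.
  by case/mulmx1_unit.
move=> t; have [r [s [A [C [sA sC Ap fC CA]]]]] := pat t.
have [r' [A' [sA' eA']]] := hg t.
exists (r + r')%N, (block_mx A 0 0 A'); split.
  move=> i j; rewrite mxE; case: fintype.split => a; rewrite mxE; case: fintype.split => b;
    by rewrite ?sA ?sA' // mxE inE eqxx.
have fA : (X t *m f <= A)%MS by apply: submx_trans CA; apply/sub_annP.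
have A0 : (row_mx A 0 <= X t *m row_mx f (h *m g))%MS.
  have -> : row_mx A (0 : 'M_(_, n)) = A *m p *m row_mx f (h *m g).
    by rewrite mul_mx_row -!mulmxA pf mulmx1 (mulmxA p) ph mul0mx mulmx0.
  exact: submxMr.
apply/eqmxP/andP; split.
  rewrite mul_mx_row mulmxA.
  have /submxP [a ->] := fA.
  have /submxP [b ->] : (X t *m h *m g <= A')%MS by rewrite eA'.
  have -> : row_mx (a *m A) (b *m A') = row_mx a b *m block_mx A 0 0 A'.
    by rewrite mul_row_block !mulmx0 addr0 add0r.
  exact: submxMl.
rewrite -[block_mx _ _ _ _]/(col_mx (row_mx A 0) (row_mx 0 A')) col_mx_sub A0 /=.
have /submxP [c cE] : (A' <= X t *m h *m g)%MS by rewrite eA'.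
have -> : row_mx 0 A' = c *m (X t *m row_mx f (h *m g)) - row_mx (c *m X t *m f) 0.
  rewrite !mul_mx_row opp_row_mx add_row_mx oppr0 addr0 mulmxA subrr.
  by rewrite cE !mulmxA.
apply: addmx_sub; first exact: submxMl.
rewrite eqmx_opp; apply: submx_trans A0.
have /submxP [a aE] := fA.
have -> : row_mx (c *m X t *m f) (0 : 'M_(_, n)) = (c *m a) *m row_mx A 0.
  by rewrite mul_mx_row mulmx0 -!mulmxA aE.
exact: submxMl.
Qed.

(** The number m of generators is kept fixed and the ambient dimension drops, so the
complement of a summand gives a configuration in the same class. *)
Lemma class_adapted (T : Type) m (K : forall n, (T -> 'M[F]_(m, n)) -> Prop) :
  (forall n X, K n X -> (0 < n)%N -> splits X) ->
  (forall n n' X (q : 'M_(n', n)) (h : 'M_(n, n')), q *m h = 1%:M -> K n X ->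
     K n' (fun t => X t *m h)) ->
  forall n X, K n X -> adapted X.
Proof.
move=> Ksplit Krestr n; elim/ltn_ind: n => n IH X KX.
have [n0|n0] := posnP n.
  subst n; exists 1%:M; first exact: unitmx1.
  move=> t; exists m, 0; split; first by move=> i [].
  by rewrite [_ *m _]thinmx0; apply: eqmx_refl.
have [k [p [f [k0 pf pat]]]] := Ksplit n X KX n0.
pose e := 1%:M - f *m p.
have ee : e *m e = e.
  rewrite /e mulmxBr mulmx1 mulmxBl mul1mx -mulmxA (mulmxA p) pf mul1mx.
  by rewrite subrr subr0.
(* A rank factorization of the complementary idempotent: h gives coordinates on the
   kernel of f, and q includes it. *)
have [n' [q [h [qh hq]]]] : exists n' (q : 'M[F]_(n', n)) (h : 'M_(n, n')),
    q *m h = 1%:M /\ h *m q = e.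
  exists (\rank e), (row_base e), (col_base e); split; last exact: mulmx_base.
  apply: (row_free_inj (row_base_free e)); apply: (row_full_inj (col_base_full e)).
  by rewrite /= mul1mx mulmxA (mulmxA (col_base e)) mulmx_base -mulmxA mulmx_base.
have fhE : f *m p + h *m q = 1%:M by rewrite hq addrC subrK.
have ph := resolution_orth pf qh fhE.
have qf : q *m f = 0 by apply: resolution_orth qh pf _; rewrite addrC.
have En : n = (k + n')%N.
  have cr : col_mx p q *m row_mx f h = 1%:M.
    by rewrite mul_col_row pf ph qf qh scalar_mx_block.
  apply/eqP; rewrite eqn_leq (mulmx1_min cr) andbT.
  by apply: (@mulmx1_min F n _ (row_mx f h) (col_mx p q)); rewrite mul_row_col.
have ad : adapted (fun t => X t *m h).
  by apply: IH; [rewrite En; lia|exact: Krestr qh KX].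
clear K IH KX Ksplit Krestr n0 e ee hq; subst n.
exact: adapted_cat pf qh fhE pat ad.
Qed.

Lemma e6_adapted m n (L W1 W2 U1 U2 : 'M[F]_(m, n)) :
  (W1 <= W2)%MS -> (U1 <= U2)%MS -> adapted (e6_config L W1 W2 U1 U2).
Proof.
move=> hW hU; pose K n (X : option (bool * bool) -> 'M[F]_(m, n)) :=
  exists L W1 W2 U1 U2, [/\ (W1 <= W2)%MS, (U1 <= U2)%MS & X =1 e6_config L W1 W2 U1 U2].
apply: (@class_adapted _ m K); last by exists L, W1, W2, U1, U2.
  move=> {hW hU L W1 W2 U1 U2}n' X [L [W1 [W2 [U1 [U2 [hW hU /funext->]]]]]] n0.
  exact: e6_splits.
move=> n1 n2 X q h _ [L' [W1' [W2' [U1' [U2' [hW' hU' XE]]]]]].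
exists (L' *m h), (W1' *m h), (W2' *m h), (U1' *m h), (U2' *m h).
by split; rewrite ?submxMr // => -[[[] []]|]; rewrite XE.
Qed.

Lemma dn_adapted m n (W W' : 'M[F]_(m, n)) (E : nat -> 'M[F]_(m, n)) r :
  E 0%N = 0 -> (1%:M <= E r)%MS ->
  (forall i j, (i <= j)%N -> (E i <= E j)%MS) -> adapted (dn_config W W' E).
Proof.
move=> E0 Er mono; pose K n (X : bool + nat -> 'M[F]_(m, n)) :=
  exists W W' E, [/\ E 0%N = 0, (1%:M <= E r)%MS,
    forall i j, (i <= j)%N -> (E i <= E j)%MS & X =1 dn_config W W' E].
apply: (@class_adapted _ m K); last by exists W, W', E.
  move=> {E0 Er mono W W' E}n' X [W [W' [E [E0 Er mono /funext->]]]] n0.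
  exact: dn_splits n0 E0 Er mono.
move=> n1 n2 X q h qh [W1 [W1' [E1 [E10 E1r mono1 XE]]]].
exists (W1 *m h), (W1' *m h), (fun i => E1 i *m h); split.
- by rewrite E10 mul0mx.
- have /submxP [z zE] := E1r; rewrite -qh -[q]mulmx1 zE -!mulmxA mulmxA.
  exact: submxMl.
- by move=> i j /mono1 h1; exact: submxMr.
- by case=> [[]|i]; rewrite XE.
Qed.

(** The three elements of 'I_3 encode 0, 1 and -1. *)
Definition signrow n (a : 'rV['I_3]_n) : 'rV[F]_n :=
  map_mx (fun i : 'I_3 => nth 0 [:: 0; 1; -1] i) a.

Definition signrows m n (Y : 'M[F]_(m, n)) : {set 'rV['I_3]_n} :=
  [set a | (signrow a <= Y)%MS]%SET.

Lemma signrows_le m1 m2 r n (Y : 'M[F]_(m1, n)) (Y' : 'M_(m2, n)) (A : 'M_(r, n)) :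
  signmx A -> (Y :=: A)%MS -> signrows Y = signrows Y' -> (Y <= Y')%MS.
Proof.
move=> sA YA e; rewrite YA; apply/row_subP=> i.
pose a : 'rV['I_3]_n := \row_j inord (index (A i j) [:: 0; 1; -1]).
have aE : signrow a = row i A.
  apply/rowP=> j; rewrite !mxE inordK; first by rewrite nth_index // sA.
  by rewrite -[3%N]/(size [:: 0 : F; 1; -1]) index_mem sA.
have : a \in signrows Y by rewrite inE aE YA row_sub.
by rewrite e inE aE.
Qed.

(** The code of a configuration lists, for each member, all the sign vectors that it
contains in a chosen adapted basis. *)
Lemma finite_codes (T : finType) (A : Type) (D : A -> Prop) m n
    (X : A -> T -> 'M[F]_(m, n)) :
  (forall x, D x -> adapted (X x)) ->
  exists (C : finType) (c : A -> C), forall x y, D x -> D y -> c x = c y ->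
    exists2 g, g \in unitmx & forall t, (X x t *m g :=: X y t)%MS.
Proof.
move=> ad; have /choice [G GP] : forall x, exists g, D x -> g \in unitmx /\
    forall t, exists r (A : 'M[F]_(r, n)), signmx A /\ (X x t *m g :=: A)%MS.
  move=> x; have [Dx|nDx] := pselect (D x); last by exists 0.
  by have [g gu h] := ad x Dx; exists g.
exists {ffun T -> {set 'rV['I_3]_n}}, (fun x => [ffun t => signrows (X x t *m G x)]).
move=> x y Dx Dy /ffunP cxy; have [gx hx] := GP x Dx; have [gy hy] := GP y Dy.
exists (G x *m invmx (G y)); first by rewrite unitmx_mul gx unitmx_inv.
move=> t; have {}cxy : signrows (X x t *m G x) = signrows (X y t *m G y).
  by have := cxy t; rewrite !ffunE.
have [r [M [sM eM]]] := hx t; have [r' [M' [sM' eM']]] := hy t.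
have h1 := signrows_le sM eM cxy; have h2 := signrows_le sM' eM' (esym cxy).
apply/eqmxP/andP; split; rewrite mulmxA.
  by rewrite -[X in (_ <= X)%MS](mulmxK gy) submxMr.
by rewrite -[X in (X <= _)%MS](mulmxK gy) submxMr.
Qed.

End Adapted.

(** * Self-dual configurations: from linear maps to isometries *)

Section Isometry.
Variable C : numClosedFieldType.

(** Roots are added one at a time, as in Hensel lifting: correcting q by a multiple c
of the current product P, the new condition at mu is a quadratic equation in c. It
is solvable because its linear coefficient 2 q(mu) is nonzero when P(mu) = 0, as
q(mu)^2 = mu then. *)
Lemma sqrtX_mod (s : seq C) : 0 \notin s ->
  exists q : {poly C}, \prod_(z <- s) ('X - z%:P) %| q ^+ 2 - 'X.
Proof.
elim: s => [|mu s IH]; first by exists 0; rewrite big_nil dvd1p.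
rewrite inE negb_or => /andP [mu0 /IH [q /dvdpP [r rE]]].
rewrite big_cons; set P := \prod_(z <- s) _ in rE *.
have [c cE] : exists c, r.[mu] + 2 * q.[mu] * c + P.[mu] * c ^+ 2 = 0.
  have [P0|P0] := eqVneq P.[mu] 0.
    have q0 : q.[mu] != 0.
      apply: contraNneq mu0 => q0; move/(congr1 (horner^~ mu)): rE.
      by rewrite !hornerE /= q0 P0 mulr0 expr0n /= sub0r => /eqP; rewrite oppr_eq0 eq_sym.
    exists (- r.[mu] / (2 * q.[mu])); rewrite P0 mul0r addr0 mulrC divfK ?subrr //.
    by rewrite mulf_neq0 // pnatr_eq0.
  move: P.[mu] q.[mu] r.[mu] P0 => Pm qm rm P0.
  pose p := Pm *: 'X^2 + (2 * qm) *: 'X + rm%:P.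
  have /closed_rootP [c /rootP] : size p != 1%N.
    rewrite /p -addrA size_polyDl ?size_scale ?size_polyXn //.
    apply: leq_ltn_trans (size_polyD _ _) _; rewrite gtn_max; apply/andP; split.
      by apply: leq_ltn_trans (size_scale_leq _ _) _; rewrite size_polyX.
    by apply: leq_ltn_trans (size_polyC_leq1 _) _.
  rewrite /p !hornerE /= => h; exists c; rewrite -[RHS]h; ring.
exists (q + c%:P * P).
have -> : (q + c%:P * P) ^+ 2 - 'X = (r + 2 * q * c%:P + P * c%:P ^+ 2) * P.
  have ringE (R : comNzRingType) (x d y w z : R) : x ^+ 2 - w = z * y ->
      (x + d * y) ^+ 2 - w = (z + 2 * x * d + y * d ^+ 2) * y.
    move=> h; have -> : (z + 2 * x * d + y * d ^+ 2) * y =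
      z * y + (2 * x * d + y * d ^+ 2) * y by ring.
    by rewrite -h; ring.
  exact: ringE.
rewrite dvdp_mul2r; last first.
  by rewrite /P prodf_seq_neq0; apply/allP => z _ /=; rewrite polyXsubC_eq0.
rewrite dvdp_XsubCl; apply/rootP; rewrite !hornerE /= -[RHS]cE; ring.
Qed.

Lemma sqrt_mx n (a : 'M[C]_n.+1) : a \in unitmx ->
  exists q : {poly C}, horner_mx a q *m horner_mx a q = a.
Proof.
move=> ua; have [s sE] := closed_field_poly_normal (char_poly a).
rewrite (monicP (char_poly_monic a)) scale1r in sE.
have s0 : 0 \notin s.
  apply/negP => s0; have : root (char_poly a) 0 by rewrite sE root_prod_XsubC.
  rewrite -eigenvalue_root_char => /eigenvalueP [v]; rewrite scale0r => va /eqP; apply.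
  by rewrite -[v]mulmx1 -(mulmxV ua) mulmxA va mul0mx.
have [q /dvdpP [r rE]] := sqrtX_mod s0; exists q.
have : horner_mx a (q ^+ 2 - 'X) = 0.
  by rewrite rE -sE rmorphM /= Cayley_Hamilton mulr0.
by rewrite rmorphB rmorphXn /= horner_mx_X => /subr0_eq.
Qed.

(** A polynomial in a self-adjoint map is self-adjoint. *)
Lemma horner_mx_adj n (a B : 'M[C]_n.+1) q :
  a *m B = B *m a^T -> horner_mx a q *m B = B *m (horner_mx a q)^T.
Proof.
move=> h; elim/poly_ind: q => [|p c IH]; first by rewrite rmorph0 trmx0 mul0mx mulmx0.
rewrite rmorphD rmorphM /= horner_mx_X horner_mx_C linearD /= trmx_mul.
rewrite mulmxDl mulmxDr -scalar_mxC tr_scalar_mx scalar_mxC; congr (_ + _).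
have comm : a *m horner_mx a p = horner_mx a p *m a.
  have : horner_mx a ('X * p) = horner_mx a (p * 'X) by rewrite mulrC.
  by rewrite !rmorphM /= horner_mx_X.
rewrite -[horner_mx a p * a]/(horner_mx a p *m a) -mulmxA h mulmxA IH.
by rewrite -mulmxA -!trmx_mul comm.
Qed.

Lemma horner_mx_stable m n (a : 'M[C]_n.+1) (X : 'M_(m, n.+1)) q :
  (X *m a <= X)%MS -> (X *m horner_mx a q <= X)%MS.
Proof.
move=> h; elim/poly_ind: q => [|p c IH]; first by rewrite rmorph0 mulmx0 sub0mx.
rewrite rmorphD rmorphM /= horner_mx_X horner_mx_C mulmxDr mulmxA addmx_sub //.
  exact: submx_trans (submxMr _ IH) h.
by rewrite mul_mx_scalar scalemx_sub.
Qed.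

Lemma stable_unit m n (a : 'M[C]_n) (X : 'M_(m, n)) :
  a \in unitmx -> (X *m a <= X)%MS -> (X *m a :=: X)%MS.
Proof.
move=> ua h; apply/eqmxP; rewrite -(geq_leqif (mxrank_leqif_eq h)).
by rewrite mxrankMfree // row_free_unit.
Qed.

Definition perp m n (B : 'M[C]_n) (X : 'M_(m, n)) : 'M_n := kermx (B *m X^T).

Lemma sub_perpP r m n (B : 'M[C]_n) (Y : 'M_(r, n)) (X : 'M_(m, n)) :
  reflect (Y *m B *m X^T = 0) (Y <= perp B X)%MS.
Proof. by rewrite -mulmxA; exact: sub_kermxP. Qed.

(** With D the pullback of B' by g, the map a = D B^-1 preserves every X t, since both
forms have the same orthogonality on the configuration. A polynomial square root b
of a preserves the X t too and carries B to D, so b^-1 g is an isometry. *)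
Lemma isometry_of_selfdual T (s : T -> T) m m' n (B B' : 'M[C]_n.+1)
    (X : T -> 'M[C]_(m, n.+1)) (X' : T -> 'M[C]_(m', n.+1)) (g : 'M_n.+1) :
  involutive s -> B^T = B -> B'^T = B' -> B \in unitmx -> B' \in unitmx ->
  (forall t, (X (s t) :=: perp B (X t))%MS) ->
  (forall t, (X' (s t) :=: perp B' (X' t))%MS) ->
  g \in unitmx -> (forall t, (X t *m g :=: X' t)%MS) ->
  exists2 k, k *m B' *m k^T = B & forall t, (X t *m k :=: X' t)%MS.
Proof.
move=> sK sB sB' uB uB' pX pX' ug gX.
pose D := g *m B' *m g^T; pose a := D *m invmx B.
have aB : a *m B = D by rewrite mulmxKV.
have ua : a \in unitmx by rewrite !unitmx_mul unitmx_tr unitmx_inv ug uB' uB.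
have DT : D^T = D by rewrite !trmx_mul trmxK sB' mulmxA.
have aBT : a *m B = B *m a^T by rewrite aB -{1}DT -aB trmx_mul sB.
have memX t r (Y : 'M_(r, n.+1)) : (Y <= X t)%MS = (Y *m g <= X' t)%MS.
  by rewrite -gX; apply/idP/idP => [/submxMr->|] //; move/(submxMr (invmx g)); rewrite !mulmxK.
have stab t : (X t *m a <= X t)%MS.
  rewrite -{2}(sK t) pX; apply/sub_perpP; rewrite -(mulmxA _ a) aB.
  have : (X t *m g <= perp B' (X' (s t)))%MS by rewrite -pX' sK gX.
  move/sub_perpP => h.
  have /submxP [z zE] : (X (s t) *m g <= X' (s t))%MS by rewrite gX.
  by rewrite /D !mulmxA -(mulmxA _ g^T) -trmx_mul zE trmx_mul mulmxA h mul0mx.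
have [q qE] := sqrt_mx ua; set b := horner_mx a q in qE.
have ub : b \in unitmx by move: ua; rewrite -qE unitmx_mul => /andP [].
have bB : b *m B = B *m b^T by apply: horner_mx_adj.
have bX t : (X t *m b :=: X t)%MS by apply/stable_unit/horner_mx_stable.
exists (invmx b *m g).
  have DE : D = b *m B *m b^T by rewrite -mulmxA -bB mulmxA qE aB.
  have -> : invmx b *m g *m B' *m (invmx b *m g)^T = invmx b *m D *m (invmx b)^T.
    by rewrite trmx_mul /D !mulmxA.
  by rewrite DE trmx_inv !mulmxA mulVmx // mul1mx mulmxK // unitmx_tr.
move=> t; rewrite mulmxA; apply: eqmx_trans (gX t); apply/eqmxMr.
by apply: eqmx_trans (eqmx_sym (eqmxMr (invmx b) (bX t))) _; rewrite mulmxK.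
Qed.

End Isometry.

(** * Zariski-connected solvable groups *)

Section ClassicalGroups.
Variables (F : fieldType) (n : nat).

Lemma SO_subgroup (B : 'M[F]_n) : is_subgroup (SO B).
Proof.
have un x : SO B x -> x \in unitmx by case=> _ h; rewrite unitmxE h unitr1.
split=> //.
- by split; rewrite ?det1 // trmx1 mul1mx mulmx1.
- move=> x y [xB xd] [yB yd]; split; last by rewrite det_mulmx xd yd mulr1.
  by rewrite trmx_mul !mulmxA -(mulmxA _ x^T) -(mulmxA _ _ x) xB yB.
move=> x Nx; have ux := un x Nx; have [xB xd] := Nx.
split; last by rewrite det_inv xd invr1.
by rewrite trmx_inv -{1}xB !mulmxA mulVmx ?unitmx_tr // mul1mx mulmxK.
Qed.

Lemma SL_subgroup : is_subgroup (SL : set 'M[F]_n).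
Proof.
have un (x : 'M[F]_n) : SL x -> x \in unitmx by move=> h; rewrite unitmxE h unitr1.
split=> //; first exact: det1.
  by move=> x y; rewrite /SL /= => xd yd; rewrite det_mulmx xd yd mulr1.
by move=> x; rewrite /SL /= => xd; rewrite det_inv xd invr1.
Qed.

End ClassicalGroups.

Section Zariski.
Variables (C : numClosedFieldType) (n : nat).
Implicit Types (g h x y : 'M[C]_n) (H Z : set 'M[C]_n).

Definition polyfun (f : 'M[C]_n -> C) : Prop :=
  exists p : {mpoly C[n * n]}, forall g, f g = p.@[fun k => mxvec g ord0 k].

Definition polymx k l (f : 'M[C]_n -> 'M[C]_(k, l)) : Prop :=
  forall i j, polyfun (fun g => f g i j).

Lemma polyfun_cst c : polyfun (fun=> c).
Proof. by exists c%:MP => g; rewrite mevalC. Qed.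

Lemma polyfunD f1 f2 : polyfun f1 -> polyfun f2 -> polyfun (fun g => f1 g + f2 g).
Proof. by case=> p hp [q hq]; exists (p + q) => g; rewrite mevalD hp hq. Qed.

Lemma polyfunM f1 f2 : polyfun f1 -> polyfun f2 -> polyfun (fun g => f1 g * f2 g).
Proof. by case=> p hp [q hq]; exists (p * q) => g; rewrite mevalM hp hq. Qed.

Lemma polyfun_sum I (r : seq I) (P : pred I) (f : I -> 'M[C]_n -> C) :
  (forall i, polyfun (f i)) -> polyfun (fun g => \sum_(i <- r | P i) f i g).
Proof.
move=> h; elim: r => [|a r IH].
  by have [p hp] := polyfun_cst 0; exists p => g; rewrite big_nil -hp.
case Pa: (P a); last by case: IH => p hp; exists p => g; rewrite big_cons Pa hp.
by have [p hp] := polyfunD (h a) IH; exists p => g; rewrite big_cons Pa -hp.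
Qed.

Lemma polyfun_prod I (r : seq I) (P : pred I) (f : I -> 'M[C]_n -> C) :
  (forall i, polyfun (f i)) -> polyfun (fun g => \prod_(i <- r | P i) f i g).
Proof.
move=> h; elim: r => [|a r IH].
  by have [p hp] := polyfun_cst 1; exists p => g; rewrite big_nil -hp.
case Pa: (P a); last by case: IH => p hp; exists p => g; rewrite big_cons Pa hp.
by have [p hp] := polyfunM (h a) IH; exists p => g; rewrite big_cons Pa -hp.
Qed.

Lemma polymx_id : polymx (fun g => g).
Proof.
by move=> i j; exists 'X_(mxvec_index i j) => g; rewrite mevalXU mxvecE.
Qed.

Lemma polymx_cst k l (M : 'M[C]_(k, l)) : polymx (fun=> M).
Proof. by move=> i j; apply: polyfun_cst. Qed.

Lemma polymxM k l r (f1 : _ -> 'M[C]_(k, l)) (f2 : _ -> 'M[C]_(l, r)) :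
  polymx f1 -> polymx f2 -> polymx (fun g => f1 g *m f2 g).
Proof.
move=> h1 h2 i j.
have [p hp] := polyfun_sum (index_enum 'I_l) xpredT
  (fun a => polyfunM (h1 i a) (h2 a j)).
by exists p => g; rewrite mxE -hp.
Qed.

Lemma polymx_tr k l (f : _ -> 'M[C]_(k, l)) :
  polymx f -> polymx (fun g => (f g)^T).
Proof. by move=> h i j; have [p hp] := h j i; exists p => g; rewrite mxE -hp. Qed.

Lemma polyfun_det k (f : _ -> 'M[C]_k) : polymx f -> polyfun (fun g => \det (f g)).
Proof.
move=> h; apply: polyfun_sum => s; apply: polyfunM; first exact: polyfun_cst.
by apply: polyfun_prod => i; apply: h.
Qed.

Lemma polyfun_comp (p : {mpoly C[n * n]}) (f : _ -> 'M[C]_n) : polymx f ->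
  polyfun (fun g => p.@[fun k => mxvec (f g) ord0 k]).
Proof.
move=> h.
have e k : polyfun (fun g => mxvec (f g) ord0 k).
  by case/mxvec_indexP: k => i j; have [q hq] := h i j; exists q => g; rewrite mxvecE.
have pw k a : polyfun (fun g => mxvec (f g) ord0 k ^+ a).
  elim: a => [|a IH]; first exact: polyfun_cst 1.
  by have [q hq] := polyfunM (e k) IH; exists q => g; rewrite exprS -hq.
have [q hq] : polyfun (fun g => \sum_(m <- msupp p)
    p@_m * \prod_i mxvec (f g) ord0 i ^+ m i).
  apply: polyfun_sum => m; apply: polyfunM; first exact: polyfun_cst.
  by apply: polyfun_prod => i; apply: pw.
by exists q => g; rewrite mevalE.
Qed.

Lemma zariski_closed_zeros J (f : J -> 'M[C]_n -> C) :
  (forall j, polyfun (f j)) -> zariski_closed [set g | forall j, f j g = 0].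
Proof.
move=> h; exists [set p | exists j, forall g, f j g = p.@[fun k => mxvec g ord0 k]].
rewrite eqEsubset; split=> g /= hg.
  by move=> p [j hp]; rewrite -hp.
by move=> j; have [p hp] := h j; rewrite hp; apply: hg; exists j.
Qed.

Lemma zariski_closed_preim Z (f : _ -> 'M[C]_n) :
  polymx f -> zariski_closed Z -> zariski_closed [set g | Z (f g)].
Proof.
move=> hf [I ->].
have := @zariski_closed_zeros {p | I p}
  (fun p g => (sval p).@[fun k => mxvec (f g) ord0 k]).
case=> [p|J hJ]; first exact: polyfun_comp.
exists J; rewrite -hJ eqEsubset; split=> g /= hg.
  by case=> p Ip; apply: hg.
by move=> p Ip; apply: (hg (exist _ p Ip)).
Qed.

(** A finite set of values would disconnect H into the closed set where f takes its
value at 1 and the closed set where it takes one of the others. *)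
Lemma connected_finite_cst H (f : 'M[C]_n -> C) (s : seq C) :
  zariski_connected H -> H 1%:M -> polyfun f ->
  (forall h, H h -> f h \in s) -> forall h, H h -> f h = f 1%:M.
Proof.
move=> conn H1 pf fs h Hh; apply: contrapT => ne.
pose Z1 := [set g | forall _ : unit, f g - f 1%:M = 0].
pose Z2 := [set g | forall _ : unit, \prod_(c <- s | c != f 1%:M) (f g - c) = 0].
have fB c : polyfun (fun g => f g - c) by apply: polyfunD => //; apply: polyfun_cst.
have c1 : zariski_closed Z1 by apply: zariski_closed_zeros => _; apply: fB.
have c2 : zariski_closed Z2.
  by apply: zariski_closed_zeros => _; apply: polyfun_prod => c; apply: fB.
have Z12 g : H g -> f g != f 1%:M -> Z2 g.
  move=> Hg gn _; apply/eqP; rewrite prodf_seq_eq0; apply/hasP.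
  by exists (f g); [exact: fs|rewrite gn subrr eqxx].
case: (conn Z1 Z2 c1 c2) => [g Hg|||g [[Hg g1] g2]].
- have [e|e] := eqVneq (f g) (f 1%:M); last by right; apply: Z12.
  by left=> _; rewrite e subrr.
- by exists 1%:M; split=> // _; rewrite subrr.
- by exists h; split=> //; apply: Z12 => //; apply/eqP.
have {}g1 : f g = f 1%:M by apply/subr0_eq/(g1 tt).
move/eqP: (g2 tt); rewrite prodf_seq_eq0 => /hasP [c _ /andP [cn]].
by rewrite g1 subr_eq0 eq_sym (negPf cn).
Qed.

Lemma smallest_subgroup H (G : set 'M[C]_n) : is_subgroup H -> G `<=` H ->
  is_subgroup (smallest (@is_subgroup C n) G).
Proof.
move=> sH GH; split.
- by move=> x /(_ H (conj sH GH)); case: sH => h _ _ _ /h.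
- by move=> M [[]].
- move=> x y hx hy M MP; case: (MP) => -[_ _ h _] _.
  by apply: h; [apply: hx|apply: hy].
- by move=> x hx M MP; case: (MP) => -[_ _ _ h] _; apply: h; apply: hx.
Qed.

Lemma comm_sub H : is_subgroup H ->
  [set g | exists x y, [/\ H x, H y & g = x *m y *m invmx x *m invmx y]] `<=` H.
Proof.
case=> _ _ hM hV g [x [y [Hx Hy ->]]].
exact: (hM _ _ (hM _ _ (hM _ _ Hx Hy) (hV _ Hx)) (hV _ Hy)).
Qed.

Lemma derived_sub H : is_subgroup H -> derived H `<=` H.
Proof. by move=> sH; exact: smallest_sub sH (comm_sub sH). Qed.

Lemma derived_subgroup H : is_subgroup H -> is_subgroup (derived H).
Proof. by move=> sH; exact: smallest_subgroup sH (comm_sub sH). Qed.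

Lemma derived_comm H x y : H x -> H y -> derived H (x *m y *m invmx x *m invmx y).
Proof. by move=> Hx Hy; apply: sub_gen_smallest; exists x, y. Qed.

Lemma derived_conj H h d : is_subgroup H -> H h -> derived H d ->
  derived H (invmx h *m d *m h).
Proof.
move=> sH Hh Dd; have [hu _ _ hV] := sH; have Hd := derived_sub sH Dd.
have [_ _ dM _] := derived_subgroup sH.
have -> : invmx h *m d *m h =
    (invmx h *m d *m invmx (invmx h) *m invmx d) *m d.
  by rewrite invmxK mulmxKV // hu.
by apply: dM => //; apply: derived_comm => //; apply: hV.
Qed.

Variable B : 'M[C]_n.
Hypothesis uB : B \in unitmx.

(** On SO B this is the inverse, written as a polynomial map. *)
Definition adjB g := invmx B *m g^T *m B.

Lemma adjBV g : SO B g -> invmx g = adjB g.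
Proof.
case=> gB _; have e : adjB g *m g = 1%:M.
  by rewrite /adjB -!mulmxA (mulmxA _ B) gB mulVmx.
have [_ ug] := mulmx1_unit e.
by rewrite -[RHS](mulmxK ug) e mul1mx.
Qed.

Lemma polymx_adjB (f : _ -> 'M[C]_n) : polymx f -> polymx (fun g => adjB (f g)).
Proof.
move=> hf; apply: polymxM; last exact: polymx_cst.
by apply: polymxM; [exact: polymx_cst|exact: polymx_tr].
Qed.

Lemma adjB1 : adjB 1%:M = 1%:M.
Proof. by rewrite /adjB trmx1 mulmx1 mulVmx. Qed.

(** If two closed sets separate the derived group, then right multiplication of a
fixed element by a commutator [x, y] preserves the side, since y ranges over the
connected group H and y = 1 gives the trivial commutator. Hence multiplication by any
element of the derived group preserves the side. *)
Lemma derived_connected H : is_subgroup H -> H `<=` SO B -> zariski_connected H ->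
  zariski_connected (derived H).
Proof.
move=> sH HSO conn Z1 Z2 c1 c2 cover [z1 [Dz1 Zz1]] [z2 [Dz2 Zz2]].
apply: contrapT => disj.
have sD := derived_subgroup sH; have [du d1 dM dV] := sD; have [hu h1 hM hV] := sH.
have push (Z Z' : set 'M[C]_n) : zariski_closed Z -> zariski_closed Z' ->
    derived H `<=` Z `|` Z' -> (forall g, derived H g -> Z g -> ~ Z' g) ->
    forall g x y, derived H g -> H x -> H y -> Z g ->
    Z (g *m (x *m y *m invmx x *m invmx y)).
  move=> cZ cZ' cov dis g x y Dg Hx Hy Zg.
  pose f y := g *m (x *m y *m invmx x *m adjB y).
  have pf : polymx f.
    apply: polymxM; first exact: polymx_cst.
    apply: polymxM; last by apply: polymx_adjB; exact: polymx_id.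
    apply: polymxM; last exact: polymx_cst.
    by apply: polymxM; [exact: polymx_cst|exact: polymx_id].
  have fE a : H a -> f a = g *m (x *m a *m invmx x *m invmx a).
    by move=> Ha; rewrite /f -adjBV //; exact: HSO.
  have Df a : H a -> derived H (f a).
    by move=> Ha; rewrite fE //; apply: dM => //; apply: derived_comm.
  rewrite -fE //; apply: contrapT => nZ.
  case: (conn _ _ (zariski_closed_preim pf cZ) (zariski_closed_preim pf cZ')).
  - by move=> a /Df /cov.
  - exists 1%:M; split=> //=.
    by rewrite /f adjB1 !mulmx1 mulmxV ?hu // mulmx1.
  - by exists y; split=> //=; case: (cov _ (Df _ Hy)).
  by move=> a [[Ha /= Za] /= Za']; apply: dis (Df _ Ha) Za Za'.
have dis12 g : derived H g -> Z1 g -> ~ Z2 g.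
  by move=> Dg g1 g2; apply: disj; exists g.
have dis21 g : derived H g -> Z2 g -> ~ Z1 g.
  by move=> Dg g1 g2; apply: disj; exists g.
have cover' : derived H `<=` Z2 `|` Z1 by move=> g /cover [];[right|left].
pose S := [set h | derived H h /\ forall g, derived H g -> Z1 g <-> Z1 (g *m h)].
have sS : is_subgroup S.
  split.
  - by move=> x [/du].
  - by split=> // g Dg; rewrite mulmx1.
  - move=> x y [Dx hx] [Dy hy]; split; first exact: dM.
    by move=> g Dg; rewrite mulmxA hx // hy //; apply: dM.
  - move=> x [Dx hx]; split; first exact: dV.
    move=> g Dg; rewrite (hx (g *m invmx x)); last by apply: dM => //; apply: dV.
    by rewrite mulmxKV // du.
have /(_ (invmx z1 *m z2)) : derived H `<=` S.
  apply: smallest_sub sS _ => _ [x [y [Hx Hy ->]]]; split; first exact: derived_comm.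
  move=> g Dg; split=> [Zg|Zg]; first exact: push c1 c2 cover dis12 _ _ _ Dg Hx Hy Zg.
  case: (cover g Dg) => // Z2g; exfalso.
  apply: (dis12 _ _ Zg); last exact: push c2 c1 cover' dis21 _ _ _ Dg Hx Hy Z2g.
  by apply: dM => //; apply: derived_comm.
case=> [|_ /(_ z1 Dz1)]; first by apply: dM => //; apply: dV.
rewrite mulKVmx ?du // => h; apply: disj; exists z2; split=> //; split=> //.
exact/h.
Qed.

End Zariski.

Section LieKolchin.
Variables (C : numClosedFieldType) (n : nat) (B : 'M[C]_n).
Hypothesis uB : B \in unitmx.

Lemma max_rank k (P : 'M[C]_k -> Prop) V0 : P V0 ->
  exists2 V, P V & forall V', P V' -> (\rank V' <= \rank V)%N.
Proof.
move=> P0; pose Q := [pred r | `[< exists V, P V /\ \rank V = r >]].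
have exQ : exists r, Q r by exists (\rank V0); apply/asboolP; exists V0.
have ubQ r : Q r -> (r <= k)%N by move=> /asboolP [V [_ <-]]; apply: rank_leq_row.
have [r /asboolP [V [PV rV]] hr] := ex_maxnP exQ ubQ.
by exists V => // V' PV'; rewrite rV; apply: hr; apply/asboolP; exists V'.
Qed.

Lemma min_rank k (P : 'M[C]_k -> Prop) V0 : P V0 ->
  exists2 V, P V & forall V', P V' -> (\rank V <= \rank V')%N.
Proof.
move=> P0; pose Q := [pred r | `[< exists V, P V /\ \rank V = r >]].
have exQ : exists r, Q r by exists (\rank V0); apply/asboolP; exists V0.
have [r /asboolP [V [PV rV]] hr] := ex_minnP exQ.
by exists V => // V' PV'; rewrite rV; apply: hr; apply/asboolP; exists V'.
Qed.

Lemma stable_eigenvector k (V a : 'M[C]_k) : V != 0 -> (V *m a <= V)%MS ->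
  exists w l, [/\ (w : 'rV_k) != 0, (w <= V)%MS & w *m a = l *: w].
Proof.
move=> V0 Va; pose A := row_base V.
have r0 : (0 < \rank V)%N by rewrite lt0n mxrank_eq0.
have /submxP [M ME] : (A *m a <= A)%MS.
  by rewrite eq_row_base; apply: submx_trans Va; rewrite submxMr ?eq_row_base.
have [l /eigenvalueP [u uM u0]] := eigenvalue_closed M r0.
exists (u *m A), l; split.
- rewrite -(mul0mx _ A) -/A; apply: contraNneq u0 => h.
  exact/eqP/(row_free_inj (row_base_free V) h).
- by apply: submx_trans (submxMl _ _) _; rewrite eq_row_base.
- by rewrite -mulmxA ME mulmxA uM scalemxAl.
Qed.

Lemma eigen_finite k (a : 'M[C]_k) :
  exists s : seq C, forall (w : 'rV_k) l, w != 0 -> w *m a = l *: w -> l \in s.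
Proof.
have [s sE] := closed_field_poly_normal (char_poly a).
rewrite (monicP (char_poly_monic a)) scale1r in sE.
exists s => w l w0 wl; rewrite -root_prod_XsubC -sE -eigenvalue_root_char.
by apply/eigenvalueP; exists w.
Qed.

(** The map rho is an antihomomorphism because matrices act on row vectors through
their transposes. By induction on the derived length, the derived group D has a
weight chi with nonzero weight space V. For h in H the value of chi at the conjugate
of x by h is one of the finitely many eigenvalues of rho x, so it does not depend on
h by connectedness, and V is stable under H. Let U be a minimal nonzero stable
subspace of V. An eigenvector w of rho x in U is moved by rho y to an eigenvector
whose eigenvalue is multiplied by chi [x, y]; by connectedness again this factor is
1. So the eigenspaces of rho x in U are stable, and by minimality rho x is scalar on
U. *)
Lemma lie_kolchin k (rho : 'M[C]_n -> 'M[C]_k) d (H : set 'M[C]_n) :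
  (0 < k)%N -> polymx rho -> is_subgroup H -> H `<=` SO B -> zariski_connected H ->
  iter d (@derived C n) H = [set 1%:M] -> rho 1%:M = 1%:M ->
  (forall x y, H x -> H y -> rho (x *m y) = rho y *m rho x) ->
  exists2 v : 'rV_k, v != 0 & forall h, H h -> exists c, v *m rho h = c *: v.
Proof.
move=> k0 prho; elim: d H => [|d IH] H sH HSO conn sol rho1 rhoM.
  exists (delta_mx 0 (Ordinal k0)).
    apply/eqP => /matrixP /(_ 0 (Ordinal k0)); rewrite !mxE !eqxx /=.
    by move/eqP; rewrite oner_eq0.
  move=> h; rewrite [H]sol => ->; exists 1; by rewrite rho1 mulmx1 scale1r.
have [hu h1 hM hV] := sH.
pose D := derived H; have sD : is_subgroup D := derived_subgroup sH.
have DH : D `<=` H := derived_sub sH.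
have [v0 v0n v0e] : exists2 v : 'rV_k, v != 0 &
    forall h, D h -> exists c, v *m rho h = c *: v.
  apply: IH => //.
  - by move=> x /DH /HSO.
  - exact: (derived_connected uB sH HSO conn).
  - by rewrite -iterSr.
  - by move=> x y /DH Hx /DH Hy; apply: rhoM.
have [chi chiE] : exists chi, forall x, D x -> v0 *m rho x = chi x *: v0.
  have /choice [chi h] : forall x, exists c, D x -> v0 *m rho x = c *: v0.
    by move=> x; have [/v0e [c]|] := pselect (D x); [exists c|exists 0].
  by exists chi.
have /rV0Pn [j vj] := v0n.
have chi_poly (f : 'M[C]_n -> 'M[C]_n) : polymx f ->
    exists2 p : 'M[C]_n -> C, polyfun p & forall y, D (f y) -> p y = chi (f y).
  move=> pf; exists (fun y => (v0 *m rho (f y)) 0 j * (v0 0 j)^-1).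
    apply: polyfunM; last exact: polyfun_cst.
    have prf : polymx (fun y => rho (f y)).
      by move=> a b; have [p hp] := prho a b; have [q hq] := polyfun_comp p pf;
         exists q => g; rewrite hp hq.
    exact: (polymxM (@polymx_cst C n _ _ v0) prf).
  by move=> y Dy; rewrite chiE // mxE mulfK.
have chi1 : chi 1%:M = 1.
  have /rowP /(_ j) : v0 *m rho 1%:M = chi 1%:M *: v0 by apply: chiE; case: sD.
  by rewrite rho1 mulmx1 !mxE -{1}[v0 0 j]mul1r => /(mulIf vj).
have rhoV h : H h -> rho (invmx h) *m rho h = 1%:M /\ rho h *m rho (invmx h) = 1%:M.
  by move=> Hh; rewrite -!rhoM ?mulmxV ?mulVmx ?rho1 //; by [apply: hu|apply: hV].
have rho0 h (v : 'rV_k) : H h -> v != 0 -> v *m rho h != 0.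
  move=> Hh; apply: contraNneq => v0'.
  by rewrite -[v]mulmx1 -(rhoV h Hh).2 mulmxA v0' mul0mx.
have chiJ h x : H h -> D x -> chi (invmx h *m x *m h) = chi x.
  move=> Hh Dx; have [s hs] := eigen_finite (rho x).
  have Dc y : H y -> D (invmx y *m x *m y) by move=> Hy; apply: derived_conj.
  have [p pp pE] := @chi_poly (fun y => adjB B y *m x *m y) ltac:(
    apply: polymxM; last exact: polymx_id;
    apply: polymxM; [apply: polymx_adjB; exact: polymx_id|exact: polymx_cst]).
  have pE' y : H y -> p y = chi (invmx y *m x *m y).
    move=> Hy; have e := adjBV uB (HSO _ Hy).
    by rewrite pE; rewrite -e //; exact: Dc.
  have := connected_finite_cst (s := s) conn h1 pp.
  move=> /(_ _ h Hh); rewrite !pE' // invmx1 mul1mx mulmx1; apply=> y Hy.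
  rewrite pE' //; apply: (hs (v0 *m rho y)); first exact: rho0.
  rewrite -mulmxA -rhoM //; last exact: DH.
  have -> : x *m y = y *m (invmx y *m x *m y) by rewrite !mulmxA mulmxV ?mul1mx ?hu.
  have Dcy := Dc y Hy; rewrite rhoM //; last exact: DH.
  by rewrite mulmxA chiE // scalemxAl.
(* V is taken of maximal rank, so it contains every vector of weight chi. *)
pose P (V : 'M[C]_k) := forall x, D x -> V *m rho x = chi x *: V.
have Psub r r' (U : 'M[C]_(r, k)) (V : 'M[C]_(r', k)) : (U <= V)%MS ->
    (forall x, D x -> V *m rho x = chi x *: V) ->
    forall x, D x -> U *m rho x = chi x *: U.
  by move=> /submxP [z ->] h x Dx; rewrite -mulmxA h // scalemxAr.
have P0 : P 0 by move=> x _; rewrite mul0mx scaler0.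
have [V PV Vmax] := max_rank P0.
have Vle r (U : 'M[C]_(r, k)) :
    (forall x, D x -> U *m rho x = chi x *: U) -> (U <= V)%MS.
  move=> hU; apply: submx_trans (addsmxSr V U) _.
  rewrite -(geq_leqif (mxrank_leqif_sup (addsmxSl V U))); apply: Vmax.
  apply: (Psub _ _ _ (col_mx V U)); first by rewrite addsmxE.
  by move=> x Dx; rewrite mul_col_mx PV // hU // scale_col_mx.
have Vst h : H h -> (V *m rho h <= V)%MS.
  move=> Hh; apply: Vle => x Dx; rewrite -mulmxA -rhoM //; last exact: DH.
  have Dc : D (invmx h *m x *m h) by apply: derived_conj.
  have -> : x *m h = h *m (invmx h *m x *m h) by rewrite !mulmxA mulmxV ?mul1mx ?hu.
  rewrite rhoM //; last exact: DH.
  by rewrite mulmxA PV // chiJ // scalemxAl.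
pose P2 (U : 'M[C]_k) :=
  [/\ U != 0, (U <= V)%MS & forall h, H h -> (U *m rho h <= U)%MS].
have P2V : P2 V.
  split=> //; have : (v0 <= V)%MS by apply: Vle.
  by apply: contraTneq => ->; rewrite submx0.
have [U [U0 UV Ust] Umin] := min_rank P2V.
have [v vn vU] : exists2 v : 'rV_k, v != 0 & (v <= U)%MS.
  by have /rowV0Pn [v vU vn] := U0; exists v.
exists v => // x Hx.
have [w [l [w0 wU wx]]] := stable_eigenvector U0 (Ust x Hx).
have l0 : l != 0.
  by apply: contraTneq (rho0 x w Hx w0) => l0; rewrite wx l0 scale0r eqxx.
pose E := (U :&: eigenspace (rho x) l)%MS.
have DC y : H y -> D (x *m y *m invmx x *m invmx y) by move=> Hy; apply: derived_comm.
have swap (u : 'rV_k) y : H y -> (u <= E)%MS -> u *m rho y *m rho x =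
    (chi (x *m y *m invmx x *m invmx y) * l) *: (u *m rho y).
  move=> Hy; rewrite sub_capmx => /andP [uU /eigenspaceP ux].
  pose c := x *m y *m invmx x *m invmx y; have Dc : D c by apply: DC.
  have cE : c *m (y *m x) = x *m y by rewrite mulmxA !mulmxKV ?hu.
  have uyx : (u *m rho (y *m x) <= V)%MS.
    by apply: submx_trans UV; apply: submx_trans (Ust _ (hM _ _ Hy Hx)); apply: submxMr.
  rewrite -mulmxA -rhoM // -[in LHS]cE rhoM; [|exact: DH|exact: hM].
  rewrite mulmxA (Psub _ _ _ V uyx PV) // rhoM // mulmxA ux.
  by rewrite -scalemxAl scalerA.
have wE : (w <= E)%MS by rewrite sub_capmx wU; apply/eigenspaceP.
have chiC y : H y -> chi (x *m y *m invmx x *m invmx y) = 1.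
  move=> Hy; have [s hs] := eigen_finite (rho x).
  have [p pp pE] := @chi_poly (fun y => x *m y *m invmx x *m adjB B y) ltac:(
    apply: polymxM; last (apply: polymx_adjB; exact: polymx_id);
    apply: polymxM; last exact: polymx_cst;
    apply: polymxM; [exact: polymx_cst|exact: polymx_id]).
  have pE' z : H z -> p z = chi (x *m z *m invmx x *m invmx z).
    move=> Hz; have e := adjBV uB (HSO _ Hz).
    by rewrite pE; rewrite -e //; exact: DC.
  have := connected_finite_cst (s := [seq e / l | e <- s]) conn h1 pp.
  move=> /(_ _ y Hy); rewrite !pE' // invmx1 !mulmx1 mulmxV ?hu // chi1; apply=> z Hz.
  rewrite pE' //; apply/mapP.
  exists (chi (x *m z *m invmx x *m invmx z) * l); last by rewrite mulfK.
  by apply: (hs (w *m rho z)); [exact: rho0|exact: swap].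
have UE : (U <= E)%MS.
  rewrite -(geq_leqif (mxrank_leqif_sup (capmxSl _ _))); apply: Umin; split.
  - by apply: contraTneq wE => E0; rewrite /E E0 submx0.
  - exact: submx_trans (capmxSl _ _) UV.
  move=> h Hh; apply/rV_subP=> u /submxP [z ->]; rewrite mulmxA.
  move: (z *m E) (submxMl z E) => u' u'E.
  rewrite sub_capmx; apply/andP; split.
    apply: submx_trans (Ust h Hh); apply: submxMr.
    exact: submx_trans u'E (capmxSl _ _).
  by apply/eigenspaceP; rewrite swap // chiC // mul1r.
have := submx_trans vU UE; rewrite sub_capmx => /andP [_ /eigenspaceP ->].
by exists l.
Qed.

End LieKolchin.

(** * A stable self-dual full flag *)

Section PerpTheory.
Variables (C : numClosedFieldType) (n : nat) (B : 'M[C]_n).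
Hypotheses (sB : B^T = B) (uB : B \in unitmx).

Lemma sub_perpC r m (Y : 'M[C]_(r, n)) (X : 'M_(m, n)) :
  (Y <= perp B X)%MS = (X <= perp B Y)%MS.
Proof.
by apply/sub_perpP/sub_perpP => h; apply: trmx_inj;
   rewrite !trmx_mul trmxK sB mulmxA h trmx0.
Qed.

Lemma perpS m1 m2 (X : 'M[C]_(m1, n)) (Y : 'M_(m2, n)) :
  (X <= Y)%MS -> (perp B Y <= perp B X)%MS.
Proof. by move=> h; rewrite sub_perpC; apply: submx_trans h _; rewrite sub_perpC. Qed.

Lemma rank_perp m (X : 'M[C]_(m, n)) : \rank (perp B X) = (n - \rank X)%N.
Proof. by rewrite mxrank_ker eqmxMfull ?mxrank_tr // row_full_unit. Qed.

Lemma perpK m (X : 'M[C]_(m, n)) : (perp B (perp B X) :=: X)%MS.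
Proof.
apply: eqmx_sym; apply/eqmxP; rewrite -(geq_leqif (mxrank_leqif_eq _)).
  by rewrite !rank_perp subKn // rank_leq_col.
by rewrite sub_perpC.
Qed.

Lemma perp_isom m (X : 'M[C]_(m, n)) (k : 'M_n) :
  k *m B *m k^T = B -> (perp B (X *m k) :=: perp B X *m k)%MS.
Proof.
move=> kB; have uk : k \in unitmx.
  have : B *m invmx B = 1%:M by rewrite mulmxV.
  by rewrite -{1}kB -!mulmxA => /mulmx1_unit [].
apply: eqmx_sym; apply/eqmxP; rewrite -(geq_leqif (mxrank_leqif_eq _)).
  have fk : row_free k by rewrite row_free_unit.
  by rewrite rank_perp !(mxrankMfree _ fk) rank_perp.
apply/sub_perpP; rewrite trmx_mul !mulmxA -(mulmxA _ k) -(mulmxA _ _ k^T) kB.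
exact/sub_perpP.
Qed.

End PerpTheory.

Section StableFlag.
Variables (C : numClosedFieldType) (n : nat) (B : 'M[C]_n).
Hypotheses (sB : B^T = B) (uB : B \in unitmx).
Variable (H : set 'M[C]_n).
Hypotheses (sH : is_subgroup H) (HSO : H `<=` SO B) (conn : zariski_connected H)
  (sol : is_solvable H).

Definition stable m (X : 'M[C]_(m, n)) := forall h, H h -> (X *m h^T <= X)%MS.

Lemma isomB h : H h -> h^T *m B *m h = B. Proof. by case/HSO. Qed.

Lemma stable_perp m (X : 'M[C]_(m, n)) : stable X -> stable (perp B X).
Proof.
move=> st h Hh; have hB : h^T *m B *m h^T^T = B by rewrite trmxK isomB.
rewrite -(perp_isom uB X hB); apply: perpS => //.
have uh : h^T \in unitmx by rewrite unitmx_tr; case: sH => hu _ _ _; apply: hu.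
by rewrite (stable_unit uh (st h Hh)).
Qed.

Lemma stableD m1 m2 (X : 'M[C]_(m1, n)) (Y : 'M_(m2, n)) :
  stable X -> (forall h, H h -> (Y *m h^T <= X + Y)%MS) -> stable (X + Y)%MS.
Proof.
move=> sX hY h Hh; rewrite addsmxMr addsmx_sub hY // andbT.
exact: submx_trans (sX h Hh) (addsmxSl _ _).
Qed.

(** Lie-Kolchin on the quotient V / A: coordinates on a complement of A in V turn the
action on the quotient into a polynomial matrix representation. *)
Lemma common_eigen_subquo a b (A : 'M[C]_(a, n)) (V : 'M_(b, n)) :
  stable A -> stable V -> ~~ (V <= A)%MS ->
  exists v : 'rV_n, [/\ (v <= V)%MS, ~~ (v <= A)%MS &
    forall h, H h -> exists c, (v *m h^T - c *: v <= A)%MS].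
Proof.
move=> sA sV VA; pose D0 := (V :\: A)%MS.
have [D [DE Dfree]] : exists D : 'M_(\rank D0, n), (D :=: D0)%MS /\ row_free D.
  by exists (row_base D0); split; [exact: eq_row_base|exact: row_base_free].
have k0 : (0 < \rank D0)%N.
  rewrite lt0n mxrank_eq0; apply: contraNneq VA => e.
  by rewrite -(addsmx_diff_cap_eq V A) -/D0 e addsmx_sub sub0mx capmxSr.
have DA : (D0 :&: <<A>>)%MS = 0.
  by apply/eqP; rewrite -submx0 (cap_eqmx (eqmx_refl _) (genmxE A)) capmx_diff.
have [pr [pr0 pr1]] : exists pr : 'M[C]_n,
    (forall r (Y : 'M_(r, n)), (Y <= A)%MS -> Y *m pr = 0) /\
    (forall r (Y : 'M_(r, n)), (Y <= D0)%MS -> Y *m pr = Y).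
  exists (proj_mx D0 <<A>>%MS); split => r Y hY; last exact: proj_mx_id.
  by apply: proj_mx_0; rewrite ?genmxE.
have [P [PA PD]] : exists P : 'M[C]_(n, \rank D0),
    (forall r (Y : 'M_(r, n)), (Y <= A)%MS -> Y *m P = 0) /\
    (forall r (Y : 'M_(r, n)), (Y <= D0)%MS -> Y *m P *m D = Y).
  exists (pr *m pinvmx D); split=> r Y hY; rewrite mulmxA.
    by rewrite pr0 // mul0mx.
  by rewrite pr1 // mulmxKpV // DE.
have DD0 : (D <= D0)%MS by rewrite DE.
have DP : D *m P = 1%:M by apply: (row_free_inj Dfree); rewrite /= PD // mul1mx.
have DV : (D <= V)%MS by apply: submx_trans DD0 (diffmxSl _ _).
have PV r (Y : 'M_(r, n)) : (Y <= V)%MS -> (Y - Y *m P *m D <= A)%MS.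
  rewrite -(addsmx_diff_cap_eq V A) => /sub_addsmxP [[u v] /= ->].
  rewrite !mulmxDl (PD _ (u *m D0)) ?submxMl // (PA _ (v *m _)); last first.
    by apply: submx_trans (submxMl _ _) (capmxSr _ _).
  rewrite mul0mx addr0 addrC addKr.
  by apply: submx_trans (submxMl _ _) (capmxSr _ _).
pose rho (h : 'M[C]_n) := D *m h^T *m P.
have [d dsol] := sol.
have prho : polymx rho.
  apply: polymxM; last exact: polymx_cst.
  by apply: polymxM; [exact: polymx_cst|apply: polymx_tr; exact: polymx_id].
have rho1 : rho 1%:M = 1%:M by rewrite /rho trmx1 mulmx1.
have rhoM x y : H x -> H y -> rho (x *m y) = rho y *m rho x.
  move=> Hx Hy; rewrite /rho trmx_mul !mulmxA.
  have : (D *m y^T - D *m y^T *m P *m D <= A)%MS.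
    by apply: PV; apply: submx_trans (sV y Hy); apply: submxMr.
  move=> /(submxMr x^T) /submx_trans /(_ (sA x Hx)) /PA.
  by rewrite !mulmxBl => /subr0_eq ->.
have [u u0 hu] := lie_kolchin uB k0 prho sH HSO conn dsol rho1 rhoM.
exists (u *m D); split.
- exact: submx_trans (submxMl _ _) DV.
- apply: contraNN u0 => /PA; rewrite -mulmxA DP mulmx1 => ->; exact: eqxx.
move=> h Hh; have [c hc] := hu h Hh; exists c.
have : (u *m D *m h^T - u *m D *m h^T *m P *m D <= A)%MS.
  apply: PV; apply: submx_trans (sV h Hh); apply: submxMr.
  exact: submx_trans (submxMl _ _) DV.
by rewrite -!(mulmxA u) -/(rho h) (mulmxA u (rho h)) hc scalemxAl (mulmxA u D).
Qed.

Definition bil (x y : 'rV[C]_n) : C := (x *m B *m y^T) 0 0.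

Lemma bilDl x y z : bil (x + y) z = bil x z + bil y z.
Proof. by rewrite /bil !mulmxDl mxE. Qed.
Lemma bilZl a x z : bil (a *: x) z = a * bil x z.
Proof. by rewrite /bil -!scalemxAl mxE. Qed.
Lemma bilC x y : bil x y = bil y x.
Proof.
rewrite /bil; have -> : x *m B *m y^T = (y *m B *m x^T)^T.
  by rewrite !trmx_mul trmxK sB mulmxA.
by rewrite mxE.
Qed.
Lemma bilDr x y z : bil z (x + y) = bil z x + bil z y.
Proof. by rewrite !(bilC z) bilDl. Qed.
Lemma bilZr a x z : bil z (a *: x) = a * bil z x.
Proof. by rewrite !(bilC z) bilZl. Qed.
Lemma bil_isom h x y : H h -> bil (x *m h^T) (y *m h^T) = bil x y.
Proof.
move=> Hh; rewrite /bil trmx_mul trmxK !mulmxA -(mulmxA _ B) -(mulmxA _ h^T).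
by rewrite (mulmxA h^T) isomB.
Qed.
Lemma bil_perp m (X : 'M[C]_(m, n)) x y : (x <= perp B X)%MS -> (y <= X)%MS -> bil x y = 0.
Proof.
move=> /sub_perpP h /submxP [z ->].
by rewrite /bil trmx_mul mulmxA h mul0mx mxE.
Qed.
Lemma bil0P x y : (x <= perp B y)%MS = (bil x y == 0).
Proof.
apply/sub_perpP/eqP; first by rewrite /bil => ->; rewrite mxE.
move=> h.
by apply/matrixP=> i j; rewrite !ord1 [RHS]mxE.
Qed.

Definition isotropic m (X : 'M[C]_(m, n)) : Prop := (X <= perp B X)%MS.

(** The eigenvalue of h on v modulo E is 1 or -1, since h preserves the nonzero value
of the form at v; by connectedness it is constant. *)
Lemma anisotropic_fixed m (E : 'M[C]_(m, n)) (v : 'rV_n) :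
  isotropic E -> (v <= perp B E)%MS -> bil v v != 0 ->
  (forall h, H h -> exists c, (v *m h^T - c *: v <= E)%MS) ->
  forall h, H h -> (v *m h^T - v <= E)%MS.
Proof.
move=> isoE vE q0 hv; have [_ h1 _ _] := sH.
pose f (h : 'M[C]_n) := bil (v *m h^T) v * (bil v v)^-1.
have fE h c : (v *m h^T - c *: v <= E)%MS -> f h = c.
  move=> hc; rewrite /f -[v *m h^T](subrK (c *: v)) bilDl bilZl bilC.
  by rewrite (bil_perp vE hc) add0r mulfK.
have pf : polyfun f.
  apply: polyfunM; last exact: polyfun_cst.
  apply: (polymxM (f1 := fun h => v *m h^T *m B)); last exact: polymx_cst.
  apply: polymxM; last exact: polymx_cst.
  by apply: polymxM; [exact: polymx_cst|apply: polymx_tr; exact: polymx_id].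
have fin h : H h -> f h \in [:: 1; -1].
  move=> Hh; have [c hc] := hv h Hh; rewrite (fE h c hc) !inE -sqrf_eq1.
  apply/eqP/(mulIf q0); rewrite mul1r -[RHS](bil_isom v v Hh).
  rewrite -[v *m h^T](subrK (c *: v)); move: (_ - _) hc => e hc.
  rewrite !(bilDl, bilDr, bilZl, bilZr) (bil_perp vE hc) (bilC e v) (bil_perp vE hc).
  by rewrite (bil_perp (submx_trans hc isoE) hc); ring.
move=> h Hh; have [c hc] := hv h Hh.
have := connected_finite_cst conn h1 pf fin Hh.
rewrite (fE h c hc) (fE 1%:M 1) => [c1|]; first by rewrite c1 scale1r in hc.
by rewrite trmx1 mulmx1 scale1r subrr sub0mx.
Qed.

Lemma rank_add_row m (E : 'M[C]_(m, n)) (v : 'rV_n) :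
  (\rank (E + v)%MS <= (\rank E).+1)%N.
Proof.
have [h _] := mxrank_adds_leqif E v; apply: leq_trans h _.
by have := rank_leq_row v; lia.
Qed.

(** If the first eigenvector v modulo E is anisotropic, it is fixed modulo E, and there
is a second one w orthogonal to it. If w is anisotropic too, a combination of v
and w is isotropic, and it is fixed modulo E. *)
Lemma isotropic_eigen (E : 'M[C]_n) :
  isotropic E -> stable E -> ((\rank E).+1.*2 <= n)%N ->
  exists v : 'rV_n, [/\ (v <= perp B E)%MS, ~~ (v <= E)%MS, bil v v = 0 &
    forall h, H h -> exists c, (v *m h^T - c *: v <= E)%MS].
Proof.
move=> isoE stE rE.
have [||v [vp vE ev]] := @common_eigen_subquo _ _ E (perp B E) stE.
- exact: stable_perp.
- apply/negP => /mxrankS; rewrite rank_perp //; lia.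
have [q0|q0] := eqVneq (bil v v) 0; first by exists v.
have fixv := anisotropic_fixed isoE vp q0 ev.
have stEv : stable (E + v)%MS.
  apply: stableD => // h Hh; rewrite -[v *m h^T](subrK v).
  by apply: addmx_sub; [apply: submx_trans (fixv h Hh) _|]; rewrite ?addsmxSl ?addsmxSr.
have rEv : (\rank (E + v)%MS <= (\rank E).+1)%N.
  exact: rank_add_row.
have [||w [wp wE ew]] := @common_eigen_subquo _ _ E (perp B (E + v)%MS) stE.
- exact: stable_perp.
- apply/negP => /mxrankS; rewrite rank_perp //; lia.
have wpE : (w <= perp B E)%MS by apply: submx_trans wp (perpS _ _); rewrite ?addsmxSl.
have wv : bil w v = 0 by apply: bil_perp wp _; rewrite addsmxSr.
have [q0'|q0'] := eqVneq (bil w w) 0; first by exists w.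
have fixw := anisotropic_fixed isoE wpE q0' ew.
pose mu := sqrtC (- (bil v v / bil w w)).
exists (v + mu *: w); split.
- by rewrite addmx_sub ?scalemx_sub.
- apply/negP => zE; move/eqP: q0; apply.
  have := bil_perp vp zE; rewrite bilDr bilZr (bilC v w) wv mulr0 addr0 //.
- rewrite !(bilDl, bilDr, bilZl, bilZr) (bilC v w) wv !mulr0 add0r addr0 mulrA.
  by rewrite -expr2 sqrtCK mulNr divfK ?subrr.
move=> h Hh; exists 1; rewrite scale1r mulmxDl -scalemxAl opprD addrACA -scalerBr.
by apply: addmx_sub; [exact: fixv|apply: scalemx_sub; exact: fixw].
Qed.

Lemma isotropic_chain r : (r.*2 <= n)%N ->
  exists E : nat -> 'M[C]_n,
    (forall i, (i <= r)%N -> [/\ \rank (E i) = i, isotropic (E i) & stable (E i)]) /\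
    (forall i, (i < r)%N -> (E i <= E i.+1)%MS).
Proof.
elim: r => [|r IH] rn.
  exists (fun=> 0); split=> // i; rewrite leqn0 => /eqP ->; split.
  - by rewrite mxrank0.
  - exact: sub0mx.
  - by move=> h _; rewrite mul0mx sub0mx.
have [|E [hE mono]] := IH; first lia.
have [rE isoE stE] := hE r (leqnn r).
have [|v [vp vE v0 ev]] := isotropic_eigen isoE stE; first by rewrite rE.
exists (fun i => if (i <= r)%N then E i else (E r + v)%MS); split.
  move=> i; rewrite leq_eqVlt => /orP [/eqP ->|]; last first.
    by rewrite ltnS => ir; rewrite ir; apply: hE.
  rewrite ltnn; split.
  - apply/eqP; rewrite eqn_leq; apply/andP; split.
      by rewrite -{2}rE; exact: rank_add_row.
    rewrite -{1}rE ltnNge; apply/negP => h; move/negP: vE; apply.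
    move: h; rewrite (geq_leqif (mxrank_leqif_sup (addsmxSl (E r) v))).
    by rewrite addsmx_sub => /andP [].
  - rewrite /isotropic addsmx_sub; apply/andP; split; rewrite sub_perpC // addsmx_sub.
      by rewrite isoE.
    by rewrite -(sub_perpC sB) vp bil0P v0 eqxx.
  apply: stableD => // h Hh; have [c hc] := ev h Hh.
  rewrite -[v *m h^T](subrK (c *: v)) addmx_sub //.
    exact: submx_trans hc (addsmxSl _ _).
  by rewrite scalemx_sub ?addsmxSr.
move=> i; rewrite ltnS => ir; have [ri|ri] := ltnP i r; first by rewrite ir mono.
have -> : i = r by apply/eqP; rewrite eqn_leq ir ri.
by rewrite leqnn addsmxSl.
Qed.

(** The lower half of the flag is a chain of stable isotropic subspaces up to rank
n./2, and the upper half consists of their orthogonals. *)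
Lemma stable_flag : exists E : nat -> 'M[C]_n,
  [/\ forall i, (i <= n)%N -> \rank (E i) = i /\ stable (E i),
      forall i j, (i <= j)%N -> (j <= n)%N -> (E i <= E j)%MS
    & forall i, (i <= n)%N -> (E (n - i)%N :=: perp B (E i))%MS].
Proof.
pose m := n./2; have mn : (m.*2 <= n)%N by rewrite /m; lia.
have nm : (n <= m.*2.+1)%N by rewrite /m; lia.
have [E [hE mono]] := isotropic_chain mn.
have Emono i j : (i <= j)%N -> (j <= m)%N -> (E i <= E j)%MS.
  move=> ij jm; elim: j ij jm => [|j IH]; first by rewrite leqn0 => /eqP ->.
  rewrite leq_eqVlt => /orP [/eqP -> //|]; rewrite ltnS => ij jm.
  by apply: submx_trans (IH ij (ltnW jm)) (mono _ jm).
pose G i := if (i <= m)%N then E i else perp B (E (n - i)%N).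
have Gr i : (i <= n)%N -> \rank (G i) = i.
  move=> i_n; rewrite /G; case: leqP => im; first by case: (hE i im).
  have nim : (n - i <= m)%N by lia.
  by rewrite rank_perp //; have [-> _ _] := hE _ nim; lia.
exists G; split.
- move=> i i_n; split; first exact: Gr.
  rewrite /G; case: leqP => im; first by case: (hE i im).
  have nim : (n - i <= m)%N by lia.
  by apply: stable_perp; case: (hE _ nim).
- move=> i j ij jn; rewrite /G; case: leqP => im; case: leqP => jm.
  + exact: Emono.
  + rewrite sub_perpC //; have mm : (m <= m)%N by [].
    have [_ iso _] := hE m mm.
    apply: submx_trans (Emono (n - j)%N m _ _) _; [lia|by []|].
    by apply: submx_trans iso (perpS _ (Emono _ _ im mm)).
  + lia.
  + by apply: perpS => //; apply: Emono; lia.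
move=> i i_n; rewrite /G; case: leqP => ni; case: leqP => im.
- have en : n = m.*2 by lia.
  have -> : (n - i)%N = m by lia.
  have -> : i = m by lia.
  have [rm iso _] := hE m (leqnn m).
  apply/eqmxP; rewrite -(geq_leqif (mxrank_leqif_eq iso)) rank_perp // rm; lia.
- exact: eqmx_sym (perpK _ _ _).
- by rewrite subKn.
- lia.
Qed.

End StableFlag.

(** * Bases in which the form is antidiagonal *)

Section Basis.
Variables (C : numClosedFieldType) (n' : nat).
Local Notation n := n'.+1.

Definition antidiag : 'M[C]_n := \matrix_(i, j) (j == rev_ord i)%:R.
Local Notation J := antidiag.

Lemma mulmxJ m (M : 'M[C]_(m, n)) i j : (M *m J) i j = M i (rev_ord j).
Proof.
rewrite mxE (bigD1 (rev_ord j)) //= big1 => [|k kj]; rewrite mxE.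
  by rewrite rev_ordK eqxx mulr1 addr0.
case: eqP => [e|_]; last by rewrite mulr0.
by move: kj; rewrite e rev_ordK eqxx.
Qed.

Lemma antidiag_tr : J^T = J.
Proof.
apply/matrixP=> i j; rewrite !mxE; congr (nat_of_bool _)%:R.
by apply/eqP/eqP => ->; rewrite rev_ordK.
Qed.

Lemma antidiagK : J *m J = 1%:M.
Proof. by apply/matrixP=> i j; rewrite mulmxJ !mxE (inj_eq rev_ord_inj) eq_sym. Qed.

Lemma antidiag_unit : J \in unitmx.
Proof. by have [] := mulmx1_unit antidiagK. Qed.

Lemma sub_pid_mx k (x : 'rV[C]_n) :
  (x <= (pid_mx k : 'M[C]_n))%MS = [forall j : 'I_n, (k <= j)%N ==> (x 0 j == 0)].
Proof.
apply/idP/forallP => [/submxP [z ->] j|h].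
  apply/implyP => kj; rewrite mxE big1 // => i _; rewrite mxE.
  case: eqP => [/= e|_]; last by rewrite mulr0.
  by rewrite e ltnNge kj mulr0.
apply/submxP; exists x; apply/rowP=> j; rewrite mxE (bigD1 j) //= mxE eqxx /=.
rewrite big1 => [|i ij]; last by rewrite mxE (inj_eq val_inj) (negPf ij) mulr0.
rewrite addr0; case: ltnP => kj; first by rewrite mulr1.
by rewrite mulr0; apply/eqP; move: (h j); rewrite kj.
Qed.

Lemma row_pid_mul k m (M : 'M[C]_(n, m)) (i : 'I_n) :
  row i ((pid_mx k : 'M[C]_n) *m M) = if (i < k)%N then row i M else 0.
Proof.
apply/rowP=> j; rewrite mxE mxE (bigD1 i) //= mxE eqxx /= big1 => [|a ai].
  by rewrite addr0; case: ltnP; rewrite ?mul1r ?mul0r ?mxE.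
by rewrite mxE (inj_eq val_inj) eq_sym (negPf ai) mul0r.
Qed.

Lemma perp_pid_mx k : (k <= n)%N ->
  ((pid_mx (n - k) : 'M[C]_n) :=: perp J (pid_mx k : 'M[C]_n))%MS.
Proof.
move=> kn; apply/eqmxP; rewrite -(geq_leqif (mxrank_leqif_eq _)).
  by rewrite rank_perp ?antidiag_unit // !rank_pid_mx // leq_subr.
apply/sub_perpP/matrixP=> i j; rewrite tr_pid_mx [RHS]mxE mxE big1 // => a _.
rewrite mulmxJ !mxE; case: eqP => [e|_]; last by rewrite mul0r.
case: ltnP => i1; last by rewrite mul0r.
case: eqP => [e'|_]; last by rewrite mulr0.
case: ltnP => a1; last by rewrite mulr0.
by move: e e' i1 a1 => /=; have := ltn_ord a; lia.
Qed.

Lemma flag_basis (E : nat -> 'M[C]_n) :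
  (forall i, (i <= n)%N -> \rank (E i) = i) ->
  (forall i j, (i <= j)%N -> (j <= n)%N -> (E i <= E j)%MS) ->
  exists2 g, g \in unitmx &
    forall i, (i <= n)%N -> ((pid_mx i : 'M[C]_n) *m g :=: E i)%MS.
Proof.
move=> rE mono.
have /choice [v hv] : forall i : 'I_n, exists v : 'rV[C]_n,
    (v <= E i.+1)%MS /\ ~~ (v <= E i)%MS.
  move=> i; have : ~~ (E i.+1 <= E i)%MS.
    by apply/negP => /mxrankS; rewrite !rE ?ltnn // ltnW.
  by move=> /row_subPn [j hj]; exists (row j (E i.+1)); rewrite row_sub.
pose g : 'M[C]_n := \matrix_i v i.
have rowpid (k : nat) (i : 'I_n) : row i ((pid_mx k : 'M[C]_n) *m g) =
    if (i < k)%N then v i else 0.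
  by rewrite row_pid_mul rowK.
have le1 k : (k <= n)%N -> ((pid_mx k : 'M[C]_n) *m g <= E k)%MS.
  move=> kn; apply/row_subP=> i; rewrite rowpid; case: ltnP => ik; last exact: sub0mx.
  by apply: submx_trans (hv i).1 (mono _ _ ik kn).
have le2 k : (k <= n)%N -> (E k <= (pid_mx k : 'M[C]_n) *m g)%MS.
  elim: k => [|k IH] kn.
    have /eqP := rE 0%N (leq0n _); rewrite mxrank_eq0 => /eqP ->; exact: sub0mx.
  pose i := Ordinal kn; have [vE vnE] := hv i.
  have step : (E k.+1 <= E k + v i)%MS.
    have sub : (E k + v i <= E k.+1)%MS by rewrite addsmx_sub mono.
    rewrite -(geq_leqif (mxrank_leqif_sup sub)) rE // ltnNge; apply/negP => h.
    move: vnE; rewrite -[nat_of_ord i]/k => /negP; apply.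
    have := mxrank_leqif_sup (addsmxSl (E k) (v i)).
    move=> /geq_leqif; rewrite rE ?(ltnW kn) // h => /esym.
    by rewrite addsmx_sub => /andP [].
  apply: submx_trans step _; rewrite addsmx_sub; apply/andP; split.
    apply: submx_trans (IH (ltnW kn)) _; apply: submxMr; apply/row_subP=> j.
    rewrite sub_pid_mx; apply/forallP=> a; apply/implyP=> ka; rewrite !mxE.
    by apply/eqP; case: eqP => [->|_] /=; rewrite ?[(_ < k)%N]ltnNge ?(ltnW ka).
  have := rowpid k.+1 i; rewrite /= ltnSn => <-; exact: row_sub.
exists g; last by move=> i i_n; apply/eqmxP; rewrite le1 // le2.
rewrite -row_full_unit -sub1mx; have := le2 n (leqnn _); rewrite pid_mx_1 mul1mx.
by apply: submx_trans; rewrite sub1mx /row_full rE.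
Qed.

(** The flag E and the standard flag are linearly equivalent and self-dual for their
forms, so [isometry_of_selfdual] makes the equivalence isometric. *)
Lemma antidiag_basis (B : 'M[C]_n) (E : nat -> 'M[C]_n) :
  B^T = B -> B \in unitmx ->
  (forall i, (i <= n)%N -> \rank (E i) = i) ->
  (forall i j, (i <= j)%N -> (j <= n)%N -> (E i <= E j)%MS) ->
  (forall i, (i <= n)%N -> (E (n - i)%N :=: perp B (E i))%MS) ->
  exists2 k, k *m B *m k^T = J &
    forall i, (i <= n)%N -> ((pid_mx i : 'M[C]_n) *m k :=: E i)%MS.
Proof.
move=> sB uB rE mono dE; have [g ug hg] := flag_basis rE mono.
have ln (t : 'I_n.+1) : (t <= n)%N by rewrite -ltnS ltn_ord.
have dstd (t : 'I_n.+1) : ((pid_mx (rev_ord t) : 'M[C]_n) :=: perp J (pid_mx t : 'M[C]_n))%MS.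
  by have := perp_pid_mx (ln t); rewrite -[X in pid_mx X]subSS.
have dE' (t : 'I_n.+1) : (E (rev_ord t) :=: perp B (E t))%MS.
  by have := dE t (ln t); rewrite -[X in E X]subSS.
have hg' (t : 'I_n.+1) : ((pid_mx t : 'M[C]_n) *m g :=: E t)%MS by apply: hg.
have [k kB hk] := isometry_of_selfdual (@rev_ordK n.+1) antidiag_tr sB
  antidiag_unit uB dstd dE' ug hg'.
exists k => // i i_n; have := hk (inord i); by rewrite inordK.
Qed.

End Basis.

(** * Connecting points by rational curves *)

Section Curves.
Variables (C : numClosedFieldType) (d : {poly C}).

(** Functions of one parameter that are regular where d does not vanish. *)
Definition ratfun (f : C -> C) : Prop :=
  exists a (r : {poly C}), forall s, d.[s] != 0 -> f s * d.[s] ^+ a = r.[s].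

Definition ratmx k l (f : C -> 'M[C]_(k, l)) : Prop :=
  forall i j, ratfun (fun s => f s i j).

Lemma ratfun_poly (p : {poly C}) : ratfun (fun s => p.[s]).
Proof. by exists 0%N, p => s _; rewrite expr0 mulr1. Qed.

Lemma ratfun_cst c : ratfun (fun=> c).
Proof. by exists 0%N, c%:P => s _; rewrite expr0 mulr1 hornerC. Qed.

Lemma ratfunD f g : ratfun f -> ratfun g -> ratfun (fun s => f s + g s).
Proof.
case=> a [p hp] [b [q hq]]; exists (a + b)%N, (p * d ^+ b + q * d ^+ a) => s ds.
by rewrite !hornerE -hp // -hq // exprD; ring.
Qed.

Lemma ratfunM f g : ratfun f -> ratfun g -> ratfun (fun s => f s * g s).
Proof.
case=> a [p hp] [b [q hq]]; exists (a + b)%N, (p * q) => s ds.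
by rewrite !hornerE -hp // -hq // exprD; ring.
Qed.

Lemma ratfun_ext f g : f =1 g -> ratfun f -> ratfun g.
Proof. by move=> e [a [p hp]]; exists a, p => s ds; rewrite -e hp. Qed.

Lemma ratfun_sum I (r : seq I) (P : pred I) (f : I -> C -> C) :
  (forall i, ratfun (f i)) -> ratfun (fun s => \sum_(i <- r | P i) f i s).
Proof.
move=> h; elim: r => [|a r IH].
  by apply: ratfun_ext (ratfun_cst 0) => s; rewrite big_nil.
case Pa: (P a); last by apply: ratfun_ext IH => s; rewrite big_cons Pa.
by apply: ratfun_ext (ratfunD (h a) IH) => s; rewrite big_cons Pa.
Qed.

Lemma ratfun_prod I (r : seq I) (P : pred I) (f : I -> C -> C) :
  (forall i, ratfun (f i)) -> ratfun (fun s => \prod_(i <- r | P i) f i s).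
Proof.
move=> h; elim: r => [|a r IH].
  by apply: ratfun_ext (ratfun_cst 1) => s; rewrite big_nil.
case Pa: (P a); last by apply: ratfun_ext IH => s; rewrite big_cons Pa.
by apply: ratfun_ext (ratfunM (h a) IH) => s; rewrite big_cons Pa.
Qed.

Lemma ratfunX f a : ratfun f -> ratfun (fun s => f s ^+ a).
Proof.
move=> h; elim: a => [|a IH]; first exact: ratfun_cst 1.
by apply: ratfun_ext (ratfunM h IH) => s; rewrite exprS.
Qed.

Lemma ratmx_cst k l (M : 'M[C]_(k, l)) : ratmx (fun=> M).
Proof. by move=> i j; apply: ratfun_cst. Qed.

Lemma ratmxM k l r (f : C -> 'M[C]_(k, l)) (g : C -> 'M[C]_(l, r)) :
  ratmx f -> ratmx g -> ratmx (fun s => f s *m g s).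
Proof.
move=> hf hg i j.
have h := ratfun_sum (index_enum 'I_l) xpredT (fun a => ratfunM (hf i a) (hg a j)).
by apply: ratfun_ext h => s; rewrite mxE.
Qed.

Lemma ratmx_tr k l (f : C -> 'M[C]_(k, l)) : ratmx f -> ratmx (fun s => (f s)^T).
Proof. by move=> h i j; apply: ratfun_ext (h j i) => s; rewrite mxE. Qed.

(** If neither closed set contained the whole curve, an equation of each would give a
nonzero polynomial in the parameter; at a common non-root, also of d, the point of
the curve would lie in neither set. *)
Lemma curve_connected n (c : C -> 'M[C]_n) (N Z1 Z2 : set 'M[C]_n) :
  ratmx c -> (forall s, d.[s] != 0 -> N (c s)) ->
  zariski_closed Z1 -> zariski_closed Z2 -> N `<=` Z1 `|` Z2 ->
  ~ (N `&` Z1 `&` Z2 !=set0) ->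
  forall s0 s1, d.[s0] != 0 -> d.[s1] != 0 -> Z1 (c s0) -> Z1 (c s1).
Proof.
move=> rc Nc [I1 ->] [I2 ->] cover disj s0 s1 d0 d1 z0.
have rp (p : {mpoly C[n * n]}) : ratfun (fun s => p.@[fun k => mxvec (c s) ord0 k]).
  have e k : ratfun (fun s => mxvec (c s) ord0 k).
    by case/mxvec_indexP: k => i j; apply: ratfun_ext (rc i j) => s; rewrite mxvecE.
  have h : ratfun (fun s => \sum_(m <- msupp p)
      p@_m * \prod_i mxvec (c s) ord0 i ^+ m i).
    apply: ratfun_sum => m; apply: ratfunM; first exact: ratfun_cst.
    by apply: ratfun_prod => i; apply: ratfunX.
  by apply: ratfun_ext h => s; rewrite mevalE.
apply: contrapT => /existsNP [p1 /not_implyP [Ip1 p1n]].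
have [n2|] := pselect (exists2 p2, I2 p2 & exists2 s2, d.[s2] != 0 &
    p2.@[fun k => mxvec (c s2) ord0 k] != 0); last first.
  move=> h; apply: disj; exists (c s0); split; first by split; [exact: Nc|].
  move=> p2 Ip2; apply: contrapT => /eqP ne; apply: h; exists p2 => //.
  by exists s0.
case: n2 => p2 Ip2 [s2 d2 p2n].
have [a1 [r1 h1]] := rp p1; have [a2 [r2 h2]] := rp p2.
have r1n : r1 != 0.
  apply/eqP => r0; move: (h1 _ d1); rewrite r0 horner0 => /eqP.
  by rewrite mulf_eq0 expf_eq0 (negPf d1) andbF orbF => /eqP.
have r2n : r2 != 0.
  apply/eqP => r0; move: (h2 _ d2); rewrite r0 horner0 => /eqP.
  by rewrite mulf_eq0 expf_eq0 (negPf d2) andbF orbF (negPf p2n).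
have dn_config : d != 0 by apply: contraNneq d0 => ->; rewrite horner0.
have /closed_nonrootP [s] : r1 * r2 * d != 0 by rewrite !mulf_neq0.
rewrite rootE !hornerM !mulf_eq0 !negb_or => /andP [/andP [r1s r2s] ds].
case: (cover _ (Nc s ds)) => /= h.
  by move: r1s; rewrite -h1 // h // mul0r eqxx.
by move: r2s; rewrite -h2 // h // mul0r eqxx.
Qed.

End Curves.

(** * The stabilizer of a self-dual flag *)

Section FlagStabilizer.
Variables (C : numClosedFieldType) (n' : nat).
Local Notation n := n'.+1.
Local Notation J := (antidiag C n').
Variables (B k : 'M[C]_n).
Hypotheses (uB : B \in unitmx) (kB : k *m B *m k^T = J).

Let uk : k \in unitmx.
Proof. by have := antidiag_unit C n'; rewrite -kB -mulmxA unitmx_mul => /andP []. Qed.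

(** The action of g on row vectors in the basis k adapted to the flag. *)
Definition flag_mx (g : 'M[C]_n) := k *m g^T *m invmx k.
Definition of_flag_mx (t : 'M[C]_n) := (invmx k *m t *m k)^T.

Lemma of_flag_mxK : cancel of_flag_mx flag_mx.
Proof. by move=> t; rewrite /flag_mx /of_flag_mx trmxK !mulmxA mulmxV // mul1mx mulmxK. Qed.

Lemma flag_mxK : cancel flag_mx of_flag_mx.
Proof. by move=> g; rewrite /flag_mx /of_flag_mx !mulmxA mulVmx // mul1mx mulmxKV // trmxK. Qed.

Lemma flag_mx1 : flag_mx 1%:M = 1%:M.
Proof. by rewrite /flag_mx trmx1 mulmx1 mulmxV. Qed.

Lemma flag_mxM x y : flag_mx (x *m y) = flag_mx y *m flag_mx x.
Proof. by rewrite /flag_mx trmx_mul !mulmxA mulmxKV. Qed.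

Lemma det_flag_mx g : \det (flag_mx g) = \det g.
Proof. by rewrite /flag_mx !det_mulmx det_tr det_inv mulrAC divff ?mul1r // -unitfE -unitmxE. Qed.

Lemma SO_flag_mx g : SO B g <-> flag_mx g *m J *m (flag_mx g)^T = J /\ \det (flag_mx g) = 1.
Proof.
rewrite det_flag_mx; have e : flag_mx g *m J *m (flag_mx g)^T = k *m (g^T *m B *m g) *m k^T.
  rewrite /flag_mx -kB !trmx_mul trmxK !mulmxA mulmxKV // -!mulmxA.
  by rewrite (mulmxA k^T) -trmx_mul mulVmx // trmx1 mul1mx.
rewrite e; split=> -[h1 h2]; split=> //; first by rewrite h1 kB.
move: h1; rewrite -kB -!mulmxA => /(can_inj (mulKmx uk)); rewrite !mulmxA.
by apply: (can_inj (mulmxK _)); rewrite unitmx_tr.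
Qed.

Lemma polymx_flag_mx : polymx flag_mx.
Proof.
apply: polymxM; last exact: polymx_cst.
by apply: polymxM; [exact: polymx_cst|apply: polymx_tr; exact: polymx_id].
Qed.

(** The elements of SO B that stabilize the flag spanned by the first rows of k. *)
Definition trigSO : set 'M[C]_n := [set g | SO B g /\ is_trig_mx (flag_mx g)].

Lemma trigSO_stable g : SO B g ->
  (forall i, (i <= n)%N ->
     ((pid_mx i : 'M[C]_n) *m k *m g^T <= (pid_mx i : 'M[C]_n) *m k)%MS) ->
  trigSO g.
Proof.
move=> Bg h; split=> //; apply/is_trig_mxP => i j ij.
have : (row i (flag_mx g) <= (pid_mx i.+1 : 'M[C]_n))%MS.
  have := submxMr (invmx k) (h i.+1 (ltn_ord i)); rewrite mulmxK // => le.
  apply: submx_trans le; rewrite -!mulmxA (mulmxA k) -/(flag_mx g).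
  by have := row_pid_mul i.+1 (flag_mx g) i; rewrite ltnSn => <-; exact: row_sub.
by rewrite sub_pid_mx => /forallP /(_ j) /implyP /(_ ij) /eqP; rewrite mxE.
Qed.

(** Matrices that lower the standard flag by at least e steps. *)
Definition lower_band (e : nat) (a : 'M[C]_n) : Prop :=
  forall i j : 'I_n, (i < j + e)%N -> a i j = 0.

Lemma lower_bandM e f a b : lower_band e a -> lower_band f b -> lower_band (e + f) (a *m b).
Proof.
move=> ha hb i j ij; rewrite mxE big1 // => c _.
have [ic|ci] := ltnP i (c + e); first by rewrite ha // mul0r.
by rewrite hb ?mulr0 //; lia.
Qed.

Lemma lower_bandD e a b : lower_band e a -> lower_band e b -> lower_band e (a + b).
Proof. by move=> ha hb i j ij; rewrite mxE ha // hb // addr0. Qed.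

Lemma lower_bandN e a : lower_band e a -> lower_band e (- a).
Proof. by move=> ha i j ij; rewrite mxE ha // oppr0. Qed.

Lemma lower_bandW e f a : (f <= e)%N -> lower_band e a -> lower_band f a.
Proof. by move=> ef ha i j ij; apply: ha; lia. Qed.

Lemma lower_band1 : lower_band 0 1%:M.
Proof. by move=> i j ij; rewrite mxE; case: eqP => // e; move: ij; rewrite e addn0 ltnn. Qed.

Lemma lower_band0P a : lower_band 0 a <-> is_trig_mx a.
Proof.
split=> [h|/is_trig_mxP h] //; last by move=> i j; rewrite addn0; apply: h.
by apply/is_trig_mxP => i j ij; apply: h; rewrite addn0.
Qed.

Lemma trigSO_unit g : trigSO g -> g \in unitmx.
Proof. by case=> -[_ h] _; rewrite unitmxE h unitr1. Qed.

Lemma flag_mxV g : g \in unitmx -> flag_mx (invmx g) *m flag_mx g = 1%:M.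
Proof. by move=> ug; rewrite -flag_mxM mulmxV // flag_mx1. Qed.

Lemma trigSO_subgroup : is_subgroup trigSO.
Proof.
have [_ SO1 SOM SOV] := SO_subgroup B; split.
- exact: trigSO_unit.
- by split; rewrite ?flag_mx1; [exact: SO1|apply/lower_band0P/lower_band1].
- move=> x y [Bx /lower_band0P xt] [By /lower_band0P yt]; split; first exact: SOM.
  by apply/lower_band0P; rewrite flag_mxM; exact: (lower_bandM yt xt).
move=> x Nx; have ux := trigSO_unit Nx; have [Bx /lower_band0P xt] := Nx.
split; first exact: SOV.
have [tB _] := (SO_flag_mx x).1 Bx.
have -> : flag_mx (invmx x) = J *m (flag_mx x)^T *m J.
  have h : flag_mx x *m (J *m (flag_mx x)^T *m J) = 1%:M.
    by rewrite !mulmxA tB antidiagK.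
  by rewrite -[LHS]mulmx1 -h mulmxA flag_mxV // mul1mx.
apply/is_trig_mxP => i j ij; rewrite mulmxJ -[J]trmxK -trmx_mul mxE antidiag_tr mulmxJ.
by apply: xt; rewrite addn0 /=; have := ltn_ord j; lia.
Qed.

Definition unip_filtr (e : nat) : set 'M[C]_n :=
  [set g | trigSO g /\ lower_band e (flag_mx g - 1%:M)].

Lemma unip_filtr0 : trigSO `<=` unip_filtr 0.
Proof. by move=> g Ng; split=> //;
   apply/lower_bandD/lower_bandN/lower_band1; case: Ng => _ /lower_band0P. Qed.

Lemma unip_filtr_subgroup e : is_subgroup (unip_filtr e).
Proof.
have [hu h1 hM hV] := trigSO_subgroup.
have tr g : trigSO g -> lower_band 0 (flag_mx g) by case=> _ /lower_band0P.
split.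
- by move=> x [/hu].
- by split=> // i j _; rewrite flag_mx1 subrr mxE.
- move=> x y [Nx xe] [Ny ye]; split; first exact: hM.
  have -> : flag_mx (x *m y) - 1%:M = (flag_mx y - 1%:M) *m flag_mx x + (flag_mx x - 1%:M).
    by rewrite flag_mxM mulmxBl mul1mx addrA subrK.
  by apply: lower_bandD => //; rewrite -[e]addn0; apply: lower_bandM => //; apply: tr.
move=> x [Nx xe]; split; first exact: hV.
have -> : flag_mx (invmx x) - 1%:M = - (flag_mx (invmx x) *m (flag_mx x - 1%:M)).
  by rewrite mulmxBr mulmx1 flag_mxV ?hu // opprB.
by apply: lower_bandN; apply: (@lower_bandM 0 e) => //; apply/tr/hV.
Qed.

(** For e = 0 the diagonal entries of a commutator of triangular matrices are 1. For
e > 0 the commutator lies even in step e + e. *)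
Lemma unip_filtr_comm e : [set g | exists x y, [/\ unip_filtr e x, unip_filtr e y &
    g = x *m y *m invmx x *m invmx y]] `<=` unip_filtr e.+1.
Proof.
move=> g [x [y [[Nx xe] [Ny ye] ->]]].
have [hu h1 hM hV] := trigSO_subgroup.
have tr g' : trigSO g' -> lower_band 0 (flag_mx g') by case=> _ /lower_band0P.
split; first exact: (hM _ _ (hM _ _ (hM _ _ Nx Ny) (hV _ Nx)) (hV _ Ny)).
have -> : flag_mx (x *m y *m invmx x *m invmx y) - 1%:M =
    flag_mx (invmx y) *m (flag_mx (invmx x) *m
      (flag_mx y *m flag_mx x - flag_mx x *m flag_mx y)).
  have alg (a a' b b' : 'M[C]_n) : a' *m a = 1%:M -> b' *m b = 1%:M ->
      b' *m (a' *m (b *m a)) - 1%:M = b' *m (a' *m (b *m a - a *m b)).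
    by move=> ha hb; rewrite !mulmxBr (mulmxA a' a) ha mul1mx hb.
  by rewrite -alg ?flag_mxV ?hu // !flag_mxM.
apply: (@lower_bandM 0 e.+1); first by apply/tr/hV.
apply: (@lower_bandM 0 e.+1); first by apply/tr/hV.
have [->|e0] := posnP e.
  have lt : lower_band 0 (flag_mx y *m flag_mx x - flag_mx x *m flag_mx y).
    by apply/lower_bandD/lower_bandN; apply: (@lower_bandM 0 0); apply: tr.
  move=> i j; rewrite addn1 ltnS leq_eqVlt => /orP [/eqP/val_inj <-|ij]; last first.
    by apply: lt; rewrite addn0.
  have dg (a b : 'M[C]_n) : lower_band 0 a -> lower_band 0 b -> (a *m b) i i = a i i * b i i.
    move=> la lb; rewrite mxE (bigD1 i) //= big1 ?addr0 // => c ci.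
    have [ic|ic] := ltnP i c; first by rewrite la ?mul0r // addn0.
    rewrite lb ?mulr0 // addn0 ltn_neqAle ic andbT.
    by apply: contra ci => /eqP/val_inj ->.
  have e1 := dg _ _ (tr _ Ny) (tr _ Nx); have e2 := dg _ _ (tr _ Nx) (tr _ Ny).
  have sub (a b : 'M[C]_n) : (a - b) i i = a i i - b i i by rewrite !mxE.
  by rewrite sub e1 e2 mulrC subrr.
have -> : flag_mx y *m flag_mx x - flag_mx x *m flag_mx y =
   (flag_mx y - 1%:M) *m (flag_mx x - 1%:M) - (flag_mx x - 1%:M) *m (flag_mx y - 1%:M).
  have alg (a b : 'M[C]_n) : (a - 1) * (b - 1) - (b - 1) * (a - 1) = a * b - b * a.
    rewrite !mulrBr !mulrBl !mulr1 !mul1r; move: (a * b) (b * a) => P Q.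
    by apply/matrixP => i j; rewrite !mxE; ring.
  by rewrite -(alg (flag_mx y) (flag_mx x)).
by apply/lower_bandD/lower_bandN; apply: (@lower_bandW (e + e)); try apply: lower_bandM => //; lia.
Qed.

Lemma iter_derived_subgroup d (H : set 'M[C]_n) :
  is_subgroup H -> is_subgroup (iter d (@derived C n) H).
Proof. by move=> sH; elim: d => //= d; apply: derived_subgroup. Qed.

Lemma trigSO_solvable : is_solvable trigSO.
Proof.
exists n; have sub d : iter d (@derived C n) trigSO `<=` unip_filtr d.
  elim: d => [|d IH]; first exact: unip_filtr0.
  apply: smallest_sub (unip_filtr_subgroup _) _ => g [x [y [/IH hx /IH hy ->]]].
  by apply: unip_filtr_comm; exists x, y.
rewrite eqEsubset; split=> g.
  move=> /sub [_ h]; have e : flag_mx g = 1%:M.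
    apply/subr0_eq/matrixP => i j; rewrite h ?mxE //.
    by have := ltn_ord i; lia.
  by have := flag_mxK 1%:M; rewrite flag_mx1 => e1; rewrite /= -(flag_mxK g) e e1.
by move=> ->; case: (iter_derived_subgroup n trigSO_subgroup).
Qed.

Lemma trigSO_closed : zariski_closed trigSO.
Proof.
pose f (x : 'I_n * 'I_n + (unit + 'I_n * 'I_n)) (g : 'M[C]_n) : C :=
  match x with
  | inl (i, j) => (g^T *m B *m g) i j - B i j
  | inr (inl _) => \det g - 1
  | inr (inr (i, j)) => (i < j)%N%:R * flag_mx g i j
  end.
have pf x : polyfun (f x).
  have pid := @polymx_id C n; have pcst := @polymx_cst C n n n.
  case: x => [[i j]|[[]|[i j]]] /=.
  - apply: polyfunD; last exact: polyfun_cst.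
    have h : polymx (fun g : 'M[C]_n => g^T *m B *m g).
      by apply: polymxM => //; apply: polymxM; [exact: polymx_tr|exact: pcst].
    exact: h.
  - by apply: polyfunD; [exact: polyfun_det|exact: polyfun_cst].
  apply: polyfunM; first exact: polyfun_cst.
  exact: polymx_flag_mx.
rewrite (_ : trigSO = [set g | forall x, f x g = 0]); first exact: zariski_closed_zeros.
rewrite eqEsubset; split=> g /=.
  case=> -[gB gd] /is_trig_mxP gt [[i j]|[[]|[i j]]] /=.
  - by rewrite gB subrr.
  - by rewrite gd subrr.
  by case: ltnP => ij; rewrite ?mul0r // gt ?mulr0.
move=> h; split; first split.
- by apply/matrixP => i j; apply/subr0_eq/(h (inl (i, j))).
- exact/subr0_eq/(h (inr (inl tt))).
apply/is_trig_mxP => i j ij; have := h (inr (inr (i, j))).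
by rewrite /= ij mul1r.
Qed.


Lemma of_flag_mx_trigSO t :
  t *m J *m t^T = J -> \det t = 1 -> is_trig_mx t -> trigSO (of_flag_mx t).
Proof. by move=> h1 h2 h3; split; [apply/SO_flag_mx|]; rewrite of_flag_mxK. Qed.

Lemma ratmx_of_flag_mx d (c : C -> 'M[C]_n) : ratmx d c -> ratmx d (fun s => of_flag_mx (c s)).
Proof.
move=> h; apply: ratmx_tr; apply: ratmxM; last exact: ratmx_cst.
by apply: ratmxM => //; exact: ratmx_cst.
Qed.

Lemma mulJtr (a b : 'M[C]_n) i j :
  (a *m J *m b^T) i j = \sum_c a i (rev_ord c) * b j c.
Proof. by rewrite mxE; apply: eq_bigr => c _; rewrite mulmxJ mxE. Qed.

(** Conjugation by the diagonal matrix with entries s^i, written so that it makes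
sense for s = 0 on lower triangular t; there it gives the diagonal part of t. *)
Definition contract (t : 'M[C]_n) (s : C) : 'M[C]_n :=
  \matrix_(i, j) (s ^+ (i - j) * t i j).

(** In the sum for the entry (i, j) all nonzero terms have the same exponent
i + j - n', and this is 0 in the only place where J is nonzero. *)
Lemma contractP t s : t *m J *m t^T = J -> is_trig_mx t ->
  contract t s *m J *m (contract t s)^T = J.
Proof.
move=> tJ /is_trig_mxP tt; apply/matrixP => i j; rewrite mulJtr.
transitivity (s ^+ (i + j - n') * (t *m J *m t^T) i j).
  rewrite mulJtr mulr_sumr; apply: eq_bigr => c _; rewrite !mxE.
  have [ci|ic] := leqP (rev_ord c) i; last by rewrite tt // !(mulr0, mul0r).
  have [cj|jc] := leqP c j; last by rewrite (tt j) // !mulr0.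
  have -> : (i + j - n' = (i - rev_ord c) + (j - c))%N.
    by move: ci => /=; have := ltn_ord c; lia.
  by rewrite exprD; ring.
rewrite tJ mxE; case: eqP => [->|_]; last by rewrite mulr0.
have -> : (i + rev_ord i - n' = 0)%N by rewrite /=; have := ltn_ord i; lia.
by rewrite mul1r.
Qed.

Lemma contract_trig t s : is_trig_mx t -> is_trig_mx (contract t s).
Proof. by move=> /is_trig_mxP tt; apply/is_trig_mxP => i j ij; rewrite mxE tt ?mulr0. Qed.

Lemma contract_det t s : is_trig_mx t -> \det (contract t s) = \det t.
Proof.
move=> tt; rewrite !det_trig ?contract_trig //; apply: eq_bigr => i _.
by rewrite mxE subnn mul1r.
Qed.

Lemma contract1 t : contract t 1 = t.
Proof. by apply/matrixP => i j; rewrite mxE expr1n mul1r. Qed.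

Lemma contract0 t : is_trig_mx t -> contract t 0 = diag_mx (\row_i t i i).
Proof.
move=> /is_trig_mxP tt; apply/matrixP => i j; rewrite !mxE.
case: (ltngtP i j) => [ij|ji|/val_inj ->].
- by rewrite (tt i j) // mulr0 -val_eqE /= (ltn_eqF ij).
- by rewrite expr0n subn_eq0 leqNgt ji mul0r -val_eqE /= (gtn_eqF ji).
by rewrite subnn eqxx mul1r mulr1n.
Qed.

Lemma diagJ (w : 'I_n -> C) : (forall i, w i * w (rev_ord i) = 1) ->
  diag_mx (\row_i w i) *m J *m (diag_mx (\row_i w i))^T = J.
Proof.
move=> h; apply/matrixP => i j; rewrite mulJtr (bigD1 j) //= big1 => [|c cj].
  rewrite !mxE eqxx addr0 mulr1n; case: eqP => [->|ne].
    by rewrite rev_ordK eqxx mulr1n mulrC h.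
  by case: eqP => [e|_]; [case: ne; rewrite e rev_ordK|rewrite mulr0n mul0r].
by rewrite [X in _ * X]mxE eq_sym (negPf cj) mulr0n mulr0.
Qed.

Lemma prod_rev (w : 'I_n -> C) : (forall i, w i * w (rev_ord i) = 1) ->
  \prod_i w i = \prod_(i | i == rev_ord i) w i.
Proof.
move=> h; rewrite (bigID (fun i => i == rev_ord i)) /= -[RHS]mulr1; congr (_ * _).
rewrite (bigID (fun i : 'I_n => (i < rev_ord i)%N)) /=.
rewrite [X in _ * X](reindex_inj rev_ord_inj) /=.
rewrite [X in _ * X](eq_bigl (fun i : 'I_n => (i != rev_ord i) && (i < rev_ord i)%N)).
  by rewrite -big_split big1 // => i _; apply: h.
move=> i; rewrite rev_ordK [rev_ord i == i]eq_sym.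
have -> : (n - (n - i.+1).+1 = i)%N by have := ltn_ord i; lia.
rewrite -[(n - i.+1)%N]/(nat_of_ord (rev_ord i)).
by case: (ltngtP i (rev_ord i)) => // /val_inj /eqP ->.
Qed.

(** For i in the first half the entry moves linearly from 1 to u i, and the opposite
entry is its inverse. A middle entry, which exists for n odd, equals 1 because the
total product is 1. *)
Lemma torus_curve (u : 'I_n -> C) : (forall i, u i * u (rev_ord i) = 1) ->
  \prod_i u i = 1 ->
  exists (d : {poly C}) (w : C -> 'I_n -> C),
    [/\ d.[0] != 0, d.[1] != 0, forall i, ratfun d (w^~ i) &
     [/\ w 0 =1 (fun=> 1), w 1 =1 u, 
      forall s i, d.[s] != 0 -> w s i * w s (rev_ord i) = 1 &
      forall s, d.[s] != 0 -> \prod_i w s i = 1]].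
Proof.
move=> hu pu; pose q i : {poly C} := 1 + (u i - 1) *: 'X.
have qE i s : (q i).[s] = 1 + (u i - 1) * s by rewrite /q !hornerE.
have u0 i : u i != 0 by apply: contra_eq_neq (hu i) => ->; rewrite mul0r eq_sym oner_eq0.
pose d := \prod_i q i.
have dE s : d.[s] = \prod_i (q i).[s] by rewrite /d horner_prod.
have d0 s i : d.[s] != 0 -> (q i).[s] != 0.
  by rewrite dE => /prodf_neq0; apply.
pose w s (i : 'I_n) := if (i < rev_ord i)%N then (q i).[s] else
  if (rev_ord i < i)%N then (q (rev_ord i)).[s]^-1 else 1.
have wJ s i : d.[s] != 0 -> w s i * w s (rev_ord i) = 1.
  move=> ds; rewrite /w !rev_ordK.
  by case: (ltngtP i (rev_ord i)) => _; rewrite ?mulr1 ?divff ?mulVf ?d0.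
exists d, w; split.
- by rewrite dE; apply/prodf_neq0 => i _; rewrite qE mulr0 addr0 oner_eq0.
- by rewrite dE; apply/prodf_neq0 => i _; rewrite qE mulr1 addrC subrK.
- move=> i; rewrite /w; case: ltnP => _; first exact: ratfun_poly.
  case: ltnP => _; last exact: ratfun_cst.
  exists 1%N, (\prod_(j | j != rev_ord i) q j) => s ds.
  by rewrite expr1 /d (bigD1 (rev_ord i)) //= hornerM mulKf // d0.
have mid s i : d.[s] != 0 -> i = rev_ord i -> w s i = 1.
  by move=> ds e; rewrite /w -e ltnn.
split=> //.
- by move=> i; rewrite /w !qE !mulr0 !addr0 invr1; case: ltnP; case: ltnP.
- move=> i; rewrite /w !qE !mulr1 !(addrC 1) !subrK.
  case: (ltngtP i (rev_ord i)) => // e.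
    by apply: (mulfI (u0 (rev_ord i))); rewrite divff ?u0 // mulrC hu.
  have {}e : i = rev_ord i by apply: val_inj.
  move: pu; rewrite prod_rev // (big_pred1 i) => [-> //|j /=].
  apply/eqP/eqP => [ej|->] //; apply: val_inj.
  by move: (congr1 val e) (congr1 val ej) => /=; have := ltn_ord i; have := ltn_ord j; lia.
move=> s ds; rewrite prod_rev; last by move=> i; apply: wJ.
by rewrite big1 // => i /eqP e; apply: mid.
Qed.

(** The first curve leads from g to its diagonal part, the second one from there
to 1. *)
Lemma trigSO_to_1 (Z1 Z2 : set 'M[C]_n) : zariski_closed Z1 -> zariski_closed Z2 ->
  trigSO `<=` Z1 `|` Z2 -> ~ (trigSO `&` Z1 `&` Z2 !=set0) ->
  forall g, trigSO g -> Z1 g -> Z1 1%:M.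
Proof.
move=> c1 c2 cover disj g [Bg tg] Zg; have [tJ td] := (SO_flag_mx g).1 Bg.
rewrite -(flag_mxK g) in Zg; move: (flag_mx g) tg tJ td Zg => t tg tJ td Zt.
pose u i := t i i.
have Zu : Z1 (of_flag_mx (diag_mx (\row_i u i))).
  have -> : diag_mx (\row_i u i) = contract t 0 by rewrite contract0.
  have rc : ratmx 1 (fun s => of_flag_mx (contract t s)).
    apply: ratmx_of_flag_mx => i j.
    apply: (@ratfun_ext _ _ (fun s => ('X : {poly C}).[s] ^+ (i - j) * t i j)).
      by move=> s; rewrite hornerX [RHS]mxE.
    by apply: ratfunM; [apply: ratfunX; exact: ratfun_poly|exact: ratfun_cst].
  have Nc s : (1 : {poly C}).[s] != 0 -> trigSO (of_flag_mx (contract t s)).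
    by move=> _; apply: of_flag_mx_trigSO; rewrite ?contractP ?contract_det ?contract_trig.
  have := curve_connected rc Nc c1 c2 cover disj (s0 := 1) (s1 := 0).
  by rewrite !hornerC oner_eq0 contract1; apply.
have uJ i : u i * u (rev_ord i) = 1.
  have := contractP 0 tJ tg; rewrite contract0 // => /matrixP /(_ i (rev_ord i)).
  rewrite mulJtr [RHS]mxE eqxx (bigD1 (rev_ord i)) //= big1 => [|c ci].
    by rewrite !mxE rev_ordK !eqxx !mulr1n addr0.
  by rewrite [X in _ * X]mxE eq_sym (negPf ci) mulr0n mulr0.
have pu : \prod_i u i = 1 by rewrite -[RHS]td det_trig.
have [d [w [d0 d1 rw [w0 w1 wJ wd]]]] := torus_curve uJ pu.
have rc : ratmx d (fun s => of_flag_mx (diag_mx (\row_i w s i))).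
  apply: ratmx_of_flag_mx => i j.
  apply: (@ratfun_ext _ _ (fun s => w s i * (i == j)%:R)).
    by move=> s; rewrite !mxE mulr_natr.
  by apply: ratfunM; [exact: rw|exact: ratfun_cst].
have Nc s : d.[s] != 0 -> trigSO (of_flag_mx (diag_mx (\row_i w s i))).
  move=> ds; apply: of_flag_mx_trigSO.
  - by apply: diagJ => i; apply: wJ.
  - by rewrite det_diag -[RHS](wd s ds); apply: eq_bigr => i _; rewrite mxE.
  by apply: diag_mx_is_trig.
have := curve_connected rc Nc c1 c2 cover disj d1 d0.
have -> : \row_i w 1 i = \row_i u i by apply/rowP => i; rewrite !mxE w1.
have -> : \row_i w 0 i = const_mx 1 by apply/rowP => i; rewrite !mxE w0.
by move=> /(_ Zu); rewrite diag_const_mx -[X in _ -> Z1 X]flag_mxK flag_mx1.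
Qed.

Lemma trigSO_connected : zariski_connected trigSO.
Proof.
move=> Z1 Z2 c1 c2 cover [g1 [N1 z1]] [g2 [N2 z2]]; apply: contrapT => disj.
have cover' : trigSO `<=` Z2 `|` Z1 by move=> g /cover [];[right|left].
have disj' : ~ (trigSO `&` Z2 `&` Z1 !=set0).
  by move=> [g [[Ng h2] h1]]; apply: disj; exists g.
have := trigSO_to_1 c1 c2 cover disj N1 z1.
have := trigSO_to_1 c2 c1 cover' disj' N2 z2.
by move=> h2 h1; apply: disj; exists 1%:M; split=> //; split=> //; case: trigSO_subgroup.
Qed.

End FlagStabilizer.

(** * Borel subgroups of SO and their flags *)

Section Borel.
Variables (C : numClosedFieldType) (n' : nat).
Local Notation n := n'.+1.
Variable B : 'M[C]_n.
Hypotheses (sB : B^T = B) (uB : B \in unitmx).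

Lemma borel_flag (H : set 'M[C]_n) : is_borel (SO B) H ->
  exists E : nat -> 'M[C]_n,
  [/\ forall i, (i <= n)%N -> \rank (E i) = i,
      forall i j, (i <= j)%N -> (j <= n)%N -> (E i <= E j)%MS,
      forall i, (i <= n)%N -> (E (n - i)%N :=: perp B (E i))%MS
    & forall g, SO B g -> (forall i, (i <= n)%N -> (E i *m g^T <= E i)%MS) -> H g].
Proof.
case=> -[[sH HSO cH] conn sol] maxH.
have [E [hE mono dE]] := stable_flag sB uB sH HSO conn sol.
have rE i (i_n : (i <= n)%N) := (hE i i_n).1.
have [k kB hk] := antidiag_basis sB uB rE mono dE.
have toN g : SO B g -> (forall i, (i <= n)%N -> (E i *m g^T <= E i)%MS) -> trigSO B k g.
  move=> Bg st; apply: (trigSO_stable kB) => // i i_n.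
  have e := hk i i_n; rewrite e.
  by apply: submx_trans (st i i_n); apply: submxMr; rewrite e.
exists E; split=> // g Bg st.
have HN : H `<=` trigSO B k.
  by move=> h Hh; apply: toN; [exact: HSO|move=> i i_n; apply: (hE i i_n).2].
rewrite -(maxH (trigSO B k)) //; first exact: toN.
split; [split|exact: trigSO_connected|exact: trigSO_solvable].
- exact: trigSO_subgroup.
- by move=> x [].
- exact: trigSO_closed.
Qed.

End Borel.

(** * Orbits on the double flag variety *)

Lemma finite_image_code (A B : Type) (D : set A) (f : A -> B) (K : finType)
    (c : A -> K) :
  (forall x y, D x -> D y -> c x = c y -> f x = f y) -> finite_set (f @` D).
Proof.
move=> h; have [[a Da]|D0] := pselect (exists a, D a); last first.
  rewrite (_ : f @` D = set0); first exact: finite_set0.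
  by rewrite eqEsubset; split=> // b [x Dx]; case: D0; exists x.
have /choice [g gP] : forall k : K, exists b, forall x, D x -> c x = k -> f x = b.
  move=> k; have [[x [Dx cx]]|nx] := pselect (exists x, D x /\ c x = k).
    by exists (f x) => y Dy cy; apply: h => //; rewrite cy.
  by exists (f a) => x Dx cx; case: nx; exists x.
apply: (@sub_finite_set _ _ (g @` setT)); last exact/finite_image/finite_finset.
by move=> _ [x Dx <-]; exists (c x) => //; rewrite -(gP _ x).
Qed.

(** Each code is refined by one bit, which tells whether f agrees with its value at a
chosen element with this code; elements that disagree are all odd relative to the
chosen one. *)
Lemma finite_image_code2 (A B : Type) (D : set A) (f : A -> B) (K : finType)
    (c : A -> K) (odd : A -> A -> Prop) :
  (forall x y, D x -> D y -> c x = c y -> f x = f y \/ odd x y) ->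
  (forall x y z, D x -> D y -> D z -> odd x y -> odd x z -> f y = f z) ->
  finite_set (f @` D).
Proof.
move=> h1 h2; have [[a Da]|D0] := pselect (exists a, D a); last first.
  rewrite (_ : f @` D = set0); first exact: finite_set0.
  by rewrite eqEsubset; split=> // b [x Dx]; case: D0; exists x.
have /choice [r rP] : forall k : K, exists x, forall y, D y -> c y = k -> D x /\ c x = k.
  move=> k; have [[x [Dx cx]]|nx] := pselect (exists x, D x /\ c x = k).
    by exists x.
  by exists a => x Dx cx; case: nx; exists x.
apply: (@finite_image_code _ _ D f _ (fun x => (c x, `[< f x = f (r (c x)) >]))).
move=> x y Dx Dy [cxy]; rewrite -cxy => e.
have [Dr cr] := rP _ x Dx erefl.
have [fx|fx] := pselect (f x = f (r (c x))).
  have fy : f y = f (r (c x)) by apply/asboolP; rewrite -e; apply/asboolP.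
  by rewrite fx fy.
have fy : ~ f y = f (r (c x)) by move/asboolP; rewrite -e => /asboolP.
apply: (h2 (r (c x))) => //.
  by case: (h1 _ _ Dr Dx cr) => // /esym.
by case: (h1 _ _ Dr Dy) => [||] //; [rewrite cr|move/esym].
Qed.

Section Orbits.
Variables (F : fieldType) (n : nat).
Implicit Types (g h x y : 'M[F]_n) (H K : set 'M[F]_n).

Lemma translateM g h (A : set 'M[F]_n) :
  translate g (translate h A) = translate (g *m h) A.
Proof.
rewrite eqEsubset; split=> x.
  by case=> _ [a Aa <-] <-; exists a => //; rewrite mulmxA.
by case=> a Aa <-; exists (h *m a); rewrite ?mulmxA //; exists a.
Qed.

Lemma translate_id H h : is_subgroup H -> H h -> translate h H = H.
Proof.
case=> hu h1 hM hV Hh; rewrite eqEsubset; split=> x.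
  by case=> a Ha <-; apply: hM.
move=> Hx; exists (invmx h *m x); first by apply: hM => //; apply: hV.
by rewrite mulKVmx // hu.
Qed.

Lemma translate_coset H g h : is_subgroup H -> g \in unitmx -> H (invmx g *m h) ->
  translate h H = translate g H.
Proof.
move=> sH ug Hgh.
by rewrite -[in RHS](translate_id sH Hgh) translateM mulKVmx.
Qed.

Lemma diagonal_orbit_act K h (a b : set 'M[F]_n) : is_subgroup K -> K h ->
  diagonal_orbit K (translate h a, translate h b) = diagonal_orbit K (a, b).
Proof.
case=> hu h1 hM hV Kh; rewrite eqEsubset; split=> x; case=> k Kk <-.
  by exists (k *m h); [exact: hM|rewrite /= !translateM].
exists (k *m invmx h); first by apply: hM => //; apply: hV.
by rewrite /= !translateM mulmxKV // hu.
Qed.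

(** The subspace of transposed vectors, as a row space. *)
Definition vsmx (U : {vspace 'cV[F]_n}) : 'M[F]_n :=
  <<\matrix_(i < \dim U) (tnth (vbasis U) i)^T>>%MS.

Lemma sub_vsmx U (x : 'rV_n) : (x <= vsmx U)%MS = (x^T \in U).
Proof.
rewrite genmxE; apply/idP/idP => [/submxP [z ->]|xU].
  rewrite mulmx_sum_row linear_sum; apply: rpred_sum => i _.
  by rewrite linearZ /= rowK trmxK rpredZ // vbasis_mem // mem_tnth.
apply/submxP; exists (\row_i coord (vbasis U) i x^T).
apply: trmx_inj; rewrite {1}(coord_vbasis xU) mulmx_sum_row linear_sum.
by apply: eq_bigr => i _; rewrite linearZ /= rowK trmxK mxE (tnth_nth 0).
Qed.

Lemma rank_vsmx U : \rank (vsmx U) = \dim U.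
Proof.
rewrite genmxE; apply/eqP; apply: inj_row_free => z.
rewrite mulmx_sum_row => /(congr1 trmx); rewrite linear_sum trmx0 => h.
apply/rowP => i; rewrite mxE.
have /freeP fr : free (vbasis U) by apply: basis_free (vbasisP U).
apply: (fr (fun i => z 0 i)); rewrite -[RHS]h; apply: eq_bigr => j _.
by rewrite linearZ /= rowK trmxK (tnth_nth 0).
Qed.

Lemma vsmx_le U U' : (vsmx U <= vsmx U')%MS = (U <= U')%VS.
Proof.
apply/idP/subvP => [h x|h].
  by rewrite -[x]trmxK -!sub_vsmx => /submx_trans; apply.
by apply/rV_subP => x; rewrite !sub_vsmx; apply: h.
Qed.

Lemma vsmx_mxact g U : (vsmx (mxact g U) :=: vsmx U *m g^T)%MS.
Proof.
apply/eqmxP/andP; split; apply/rV_subP => x.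
  rewrite sub_vsmx => /memv_imgP [u uU]; rewrite lfunE /= => /(congr1 trmx).
  rewrite trmxK trmx_mul => ->; apply: submxMr.
  by rewrite sub_vsmx trmxK.
case/submxP=> z ->; rewrite mulmxA; move: (z *m _) (submxMl z (vsmx U)) => u.
rewrite !sub_vsmx trmx_mul trmxK => uU; apply/memv_imgP; exists u^T => //.
by rewrite lfunE.
Qed.

Lemma vsmx_inj U U' : (vsmx U :=: vsmx U')%MS -> U = U'.
Proof.
by move=> h; apply/eqP; rewrite eqEsubv -!vsmx_le !h submx_refl.
Qed.

Lemma mxactP g U : mxact g U = U <-> (vsmx U *m g^T :=: vsmx U)%MS.
Proof.
split=> [e|h]; last by apply: vsmx_inj; apply: eqmx_trans (vsmx_mxact g U) h.
by rewrite -{2}e; apply: eqmx_sym; apply: vsmx_mxact.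
Qed.

Lemma stabilizer_subgroup I (H : set 'M[F]_n) (S : I -> Prop) V : is_subgroup H ->
  is_subgroup [set g | H g /\ forall i, S i -> mxact g (V i) = V i].
Proof.
case=> hu h1 hM hV; split.
- by move=> x [/hu].
- by split=> // i _; apply/mxactP; rewrite trmx1 mulmx1.
- move=> x y [Hx hx] [Hy hy]; split=> [|i Si]; first exact: hM.
  apply/mxactP; rewrite trmx_mul mulmxA.
  exact: eqmx_trans (eqmxMr _ ((mxactP _ _).1 (hy i Si))) ((mxactP _ _).1 (hx i Si)).
move=> x [Hx hx]; split=> [|i Si]; first exact: hV.
apply/mxactP; apply: eqmx_trans (eqmxMr _ (eqmx_sym ((mxactP _ _).1 (hx i Si)))) _.
by rewrite -mulmxA trmx_inv mulmxV ?mulmx1 // unitmx_tr hu.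
Qed.

Lemma mxact_transport (x y h : 'M[F]_n) U : y \in unitmx ->
  (vsmx U *m x^T *m h^T :=: vsmx U *m y^T)%MS -> mxact (invmx y *m h *m x) U = U.
Proof.
move=> uy e; apply/mxactP; rewrite !trmx_mul !mulmxA.
apply: eqmx_trans (eqmxMr _ e) _.
by rewrite trmx_inv mulmxK // unitmx_tr.
Qed.

End Orbits.

Section Finiteness.
Variables (C : numClosedFieldType) (n' : nat).
Local Notation n := n'.+1.
Variable B : 'M[C]_n.
Hypotheses (sB : B^T = B) (uB : B \in unitmx).

(** X attaches a self-dual configuration to a pair x of representatives of cosets; the
last hypothesis says that the configuration determines both cosets. *)
Lemma finite_type_config (P Q : set 'M[C]_n) (T : finType) (s : T -> T) m
    (X : 'M[C]_n * 'M[C]_n -> T -> 'M[C]_(m, n)) :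
  is_subgroup P -> is_subgroup Q -> involutive s ->
  (forall x, SO B x.1 -> SL x.2 -> adapted (X x)) ->
  (forall x t, SO B x.1 -> SL x.2 -> (X x (s t) :=: perp B (X x t))%MS) ->
  (forall x y h, SO B x.1 -> SL x.2 -> SO B y.1 -> SL y.2 -> SO B h ->
     (forall t, X x t *m h^T :=: X y t)%MS ->
     Q (invmx y.1 *m h *m x.1) /\ P (invmx y.2 *m h *m x.2)) ->
  finite_type SL (SO B) P Q.
Proof.
move=> sP sQ sK adX dualX stabX.
pose D := [set x : 'M[C]_n * 'M[C]_n | SO B x.1 /\ SL x.2].
pose f (x : 'M[C]_n * 'M[C]_n) :=
  diagonal_orbit (SO B) (translate x.1 Q, translate x.2 P).
have sK' := SO_subgroup B; have [Ku K1 KM KV] := sK'.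
have [SLu _ SLM SLV] := SL_subgroup C n.
have fE x y h : D x -> D y -> SO B h ->
    (forall t, X x t *m h^T :=: X y t)%MS -> f x = f y.
  move=> [x1 x2] [y1 y2] Kh hX; have [q p] := stabX x y h x1 x2 y1 y2 Kh hX.
  rewrite /f -(diagonal_orbit_act _ _ sK' Kh) !translateM.
  rewrite (translate_coset (g := y.1) sQ) ?mulmxA ?Ku //.
  by rewrite (translate_coset (g := y.2) sP) ?mulmxA ?SLu.
apply: (@sub_finite_set _ _ (f @` D)).
  by move=> _ [[_ _] [/= [k Kk <-] [g Gg <-]] <-]; exists (k, g).
pose odd x y := exists h, [/\ h^T *m B *m h = B, \det h = -1 &
  forall t, (X x t *m h^T :=: X y t)%MS].
have [K [c cP]] := finite_codes (D := D) (fun x (Dx : D x) => adX x Dx.1 Dx.2).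
apply: (@finite_image_code2 _ _ D f K c odd).
  move=> x y Dx Dy cxy; have [g ug gX] := cP x y Dx Dy cxy.
  have [k kB kX] := isometry_of_selfdual sK sB sB uB uB
    (fun t => dualX x t Dx.1 Dx.2) (fun t => dualX y t Dy.1 Dy.2) ug gX.
  have dB : \det B != 0 by rewrite -unitfE -unitmxE.
  have : \det k ^+ 2 == 1.
    apply/eqP/(mulIf dB); rewrite mul1r -[RHS](congr1 determinant kB).
    by rewrite !det_mulmx det_tr; ring.
  rewrite sqrf_eq1 => /orP [] /eqP dk; [left|right].
    apply: (fE _ _ k^T) => //; first by split; rewrite ?trmxK // det_tr.
    by move=> t; rewrite trmxK.
  by exists k^T; split; rewrite ?trmxK // ?det_tr // => t; rewrite trmxK.
move=> x y z Dx Dy Dz [h1 [h1B h1d h1X]] [h2 [h2B h2d h2X]].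
have u1 : h1 \in unitmx by rewrite unitmxE h1d unitrN1.
apply: (fE _ _ (h2 *m invmx h1)) => //.
  split; last by rewrite det_mulmx det_inv h1d h2d invrN1 mulrNN mulr1.
  rewrite trmx_mul !mulmxA -(mulmxA _ h2^T) -(mulmxA _ _ h2) h2B -{1}h1B.
  by rewrite trmx_inv !mulmxA mulVmx ?unitmx_tr // mul1mx mulmxK.
move=> t; rewrite trmx_mul mulmxA; apply: eqmx_trans _ (h2X t); apply: eqmxMr.
apply: eqmx_trans (eqmxMr _ (eqmx_sym (h1X t))) _.
by rewrite trmx_inv mulmxK // unitmx_tr.
Qed.

Lemma adapted_comp (T T' : Type) (s : T' -> T) m (X : T -> 'M[C]_(m, n)) :
  adapted X -> adapted (fun t => X (s t)).
Proof. by case=> g ug h; exists g. Qed.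

Lemma SO_tr_isom x : SO B x -> x^T *m B *m (x^T)^T = B.
Proof. by case=> h _; rewrite trmxK. Qed.

(** Orbits on K/H map onto orbits on K/Q for a Borel subgroup H of Q, so the flag of H
is used in place of a flag of Q. *)
Lemma finite_type_grassmannian (U : {vspace 'cV[C]_n}) (P Q : set 'M[C]_n) :
  P = [set g | SL g /\ mxact g U = U] -> is_parabolic (SO B) Q ->
  finite_type SL (SO B) P Q.
Proof.
move=> PE [[sQ QSO _] [H bH HQ]].
have [E [rE mono dE HE]] := borel_flag sB uB bH.
have [Ku K1 KM KV] := SO_subgroup B; have [SLu _ SLM SLV] := SL_subgroup C n.
have sP : is_subgroup P.
  rewrite PE; have := @stabilizer_subgroup C n unit SL (fun=> True) (fun=> U)
    (SL_subgroup C n).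
  by congr is_subgroup; rewrite eqEsubset; split=> g /= [h1 h2]; split=> //; apply: (h2 tt).
pose emb (t : bool + 'I_n.+1) : bool + nat :=
  match t with inl b => inl b | inr i => inr (nat_of_ord i) end.
pose W (x : 'M[C]_n * 'M[C]_n) := vsmx U *m x.2^T.
pose X (x : 'M[C]_n * 'M[C]_n) t :=
  dn_config (W x) (perp B (W x)) (fun i => E (minn i n) *m x.1^T) (emb t).
pose s (t : bool + 'I_n.+1) : bool + 'I_n.+1 :=
  match t with inl b => inl (~~ b) | inr i => inr (rev_ord i) end.
have ln (i : 'I_n.+1) : (i <= n)%N by rewrite -ltnS ltn_ord.
have XE x (i : 'I_n.+1) : X x (inr i) = E i *m x.1^T.
  by rewrite /X /dn_config /emb (minn_idPl (ln i)).
apply: (@finite_type_config P Q _ s n X) => //.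
- by case=> [b|i] /=; rewrite ?negbK ?rev_ordK.
- move=> x x1 x2; apply: adapted_comp; apply: (@dn_adapted _ _ _ _ _ _ n).
  + have /eqP := rE 0%N (leq0n _); rewrite mxrank_eq0 min0n => /eqP ->.
    by rewrite mul0mx.
  + rewrite minnn sub1mx row_full_unit unitmx_mul unitmx_tr (Ku _ x1) andbT.
    by rewrite -row_full_unit /row_full rE.
  + move=> i j ij; apply/submxMr/mono; last exact: geq_minr.
    by move: ij; clear; lia.
- move=> x [[]|i] x1 x2.
  + exact: eqmx_sym (perpK sB uB _).
  + exact: eqmx_refl.
  rewrite (_ : s (inr i) = inr (rev_ord i)) // !XE.
  apply: eqmx_trans (eqmx_sym (perp_isom uB _ (SO_tr_isom x1))).
  by apply/eqmxMr/(dE i (ln i)).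
move=> x y h x1 x2 y1 y2 Kh hX; split.
  apply: HQ; apply: HE; first exact: KM _ _ (KM _ _ (KV _ y1) Kh) x1.
  move=> i i_n; have := hX (inr (inord i)).
  rewrite !XE inordK ?ltnS // => e.
  have uy : y.1 \in unitmx by apply: Ku.
  rewrite !trmx_mul !mulmxA (eqmxMr _ e) trmx_inv mulmxK ?unitmx_tr //.
have uy : y.2 \in unitmx by apply: SLu.
rewrite PE; split; last exact: mxact_transport (hX (inl false)).
exact: SLM _ _ (SLM _ _ (SLV _ y2) Kh.2) x2.
Qed.

Lemma lagrangian_perp (L : {vspace 'cV[C]_n}) : is_lagrangian B L ->
  (vsmx L :=: perp B (vsmx L))%MS.
Proof.
case=> dL iso; have le : (vsmx L <= perp B (vsmx L))%MS.
  apply/rV_subP => x xL; rewrite sub_perpC //; apply/rV_subP => y yL.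
  apply/sub_perpP; move: xL yL; rewrite !sub_vsmx => xL yL.
  by have := iso _ _ yL xL; rewrite trmxK.
apply/eqmxP; rewrite -(geq_leqif (mxrank_leqif_eq le)) rank_perp // rank_vsmx.
by move: dL; lia.
Qed.

Lemma finite_type_lagrangian (U1 U2 : {vspace 'cV[C]_n}) (P Q : set 'M[C]_n) :
  (U1 <= U2)%VS ->
  P = [set g | SL g /\ (mxact g U1 = U1 /\ mxact g U2 = U2)] ->
  is_lagrangian_stabilizer B Q -> finite_type SL (SO B) P Q.
Proof.
move=> U12 PE [L lagL QE].
have [Ku K1 KM KV] := SO_subgroup B; have [SLu _ SLM SLV] := SL_subgroup C n.
have sP : is_subgroup P.
  rewrite PE; have := @stabilizer_subgroup C n bool SL (fun=> True)
    (fun b => if b then U2 else U1) (SL_subgroup C n).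
  congr is_subgroup; rewrite eqEsubset; split=> g /= [h1 h2]; split=> //.
    by split; [apply: (h2 false)|apply: (h2 true)].
  by case: h2 => ? ? [].
have sQ : is_subgroup Q.
  rewrite QE; have := @stabilizer_subgroup C n unit (SO B) (fun=> True) (fun=> L)
    (SO_subgroup B).
  by congr is_subgroup; rewrite eqEsubset; split=> g /= [h1 h2]; split=> //; apply: (h2 tt).
pose W1 (x : 'M[C]_n * 'M[C]_n) := vsmx U1 *m x.2^T.
pose W2 (x : 'M[C]_n * 'M[C]_n) := vsmx U2 *m x.2^T.
pose X x := e6_config (vsmx L *m x.1^T) (W1 x) (W2 x) (perp B (W2 x)) (perp B (W1 x)).
pose s (t : option (bool * bool)) := if t is Some (a, b) then Some (~~ a, ~~ b) else None.
have W12 x : (W1 x <= W2 x)%MS by apply: submxMr; rewrite vsmx_le.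
apply: (@finite_type_config P Q _ s n X) => //.
- by case=> [[a b]|] //=; rewrite !negbK.
- by move=> x x1 x2; apply: e6_adapted => //; apply: perpS.
- move=> x [[[] []]|] x1 x2 /=.
  + exact: eqmx_sym (perpK sB uB _).
  + exact: eqmx_sym (perpK sB uB _).
  + exact: eqmx_refl.
  + exact: eqmx_refl.
  apply: eqmx_trans (eqmx_sym (perp_isom uB _ (SO_tr_isom x1))).
  by apply/eqmxMr/lagrangian_perp.
move=> x y h x1 x2 y1 y2 Kh hX; split.
  rewrite QE; split; first exact: KM _ _ (KM _ _ (KV _ y1) Kh) x1.
  by apply: mxact_transport (hX None); apply: Ku.
have uy : y.2 \in unitmx by apply: SLu.
rewrite PE; split; last first.
  by split; [exact: mxact_transport (hX (Some (false, false)))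
            |exact: mxact_transport (hX (Some (false, true)))].
exact: SLM _ _ (SLM _ _ (SLV _ y2) Kh.2) x2.
Qed.

End Finiteness.

Theorem mainTheorem7 (R : realType) (n : nat) (B : 'M[R[i]]_n)
    (B_sym : B^T = B) (B_nondeg : B \in unitmx)
    (S : {set 'I_n.-1}) (P : set 'M[R[i]]_n)
    (P_S : is_parabolic_of_type S P) :
  (forall (i : 'I_n.-1) (Q : set 'M[R[i]]_n),
     S = [set i]%SET -> is_parabolic (SO B) Q ->
     finite_type SL (SO B) P Q) /\
  (forall (m : nat) (i j : 'I_n.-1) (Q : set 'M[R[i]]_n),
     n = (2 * m)%N -> S = [set i; j]%SET -> is_lagrangian_stabilizer B Q ->
     finite_type SL (SO B) P Q).
Proof.
case: n B B_sym B_nondeg S P P_S => [|n] B sB uB S P [V [dV mV] PE].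
  by split=> [[]|m []].
split=> [i Q SE|m i j Q _ SE].
  apply: (finite_type_grassmannian sB uB (U := V i)).
  rewrite PE eqEsubset; split=> g /= [h1 h2]; split=> //.
    by apply: h2; rewrite SE inE.
  by move=> k; rewrite SE inE => /eqP ->.
wlog ij : i j SE / (i <= j)%N.
  by move=> h; case: (leqP i j) => [|/ltnW] ij; apply: h ij => //; rewrite finset.setUC.
have iS : i \in S by rewrite SE !inE eqxx.
have jS : j \in S by rewrite SE !inE eqxx orbT.
apply: (finite_type_lagrangian sB uB (mV i j iS jS ij)).
rewrite PE eqEsubset; split=> g /= [h1 h2]; split=> //.
  by split; apply: h2.
by move=> k; rewrite SE !inE => /orP [] /eqP ->; case: h2.
Qed.
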